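(* Assume that the residue field $k=A/pA$ is algebraically closed and that $a_1,a_2,a_3\in\mathbb{Z}_p$. Let $\delta^X$ be an arithmetic $\delta^A$-flow on $\widehat X$, with attached Frobenius lift $\phi^X$, such that (1) $\delta^XH_1=\delta^XH_2=0$ in $\mathcal{O}(\widehat X)$; (2) for every $c=(c_1,c_2)\in A^2$ with $\delta^A c_1=\delta^A c_2=0$ and $N(c_1,c_2)\cdot A_{p-1}(c_1,c_2)\in A^\times$, one has in $\Omega^1_{\widehat{E^0_c}}$ $$\frac{\phi_c^*}{p}\omega_c\equiv A_{p-1}(c_1,c_2)^{-1}\cdot\omega_c\pmod p.$$ Let $c=(c_1,c_2)$ with $c_1,c_2\in\mathbb{Z}_p$, $\delta^A c_1=\delta^A c_2=0$ and $N(c_1,c_2)\cdot A_{p-1}(c_1,c_2)\in A^\times$, and assume that $\mathcal{E}_c$ does not have a Frobenius lift. Let $\psi_c\in\mathcal{O}(J^2(\mathcal{E}_c))$ be the canonical $\delta$-character of $\mathcal{E}_c$ (normalized with respect to $\omega_c$), let $\sigma_c^2:\widehat{E^0_c}\to J^2(E^0_c)$ be the section induced by $\phi_c$, and let $K_c$ be the function field of $\mathcal{E}_c\otimes k$. Then the image of $\sigma_c^{2*}\psi_c$ in $K_c$ is a $p$-th power in $K_c$.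
   Context: **Base ring, Frobenius lifts, $p$-derivations.** Let $p$ be an odd prime and $A$ a complete discrete valuation ring with maximal ideal generated by $p$ and perfect residue field $k=A/pA$ (so $\mathbb{Z}_p\subset A$). Let $\phi^A:A\to A$ be its unique Frobenius lift, i.e. the unique ring endomorphism whose reduction mod $p$ is the $p$-power Frobenius, and put $\delta^A(a)=(\phi^A(a)-a^p)/p$. More generally, on a $p$-torsion free ring $B$ a $p$-derivation is a map $\delta:B\to B$ such that $\phi(b)=b^p+p\,\delta b$ is a ring homomorphism. A hat denotes $p$-adic completion of schemes over $A$. A Frobenius lift on a scheme or $p$-adic formal scheme $Y$ over $A$ is an endomorphism of $Y$, compatible with $\phi^A$, whose reduction mod $p$ is the $p$-power Frobenius. An arithmetic $\delta^A$-flow on a $p$-adic formal scheme $Y$ ($p$-torsion free) is a map of sheaves of sets $\delta^Y:\mathcal{O}_Y\to\mathcal{O}_Y$ such that $b\mapsto b^p+p\,\delta^Y b$ is a map of sheaves of rings (compatible with $\phi^A$ on $A$), hence defines a Frobenius lift $\phi^Y$ on $Y$, said to be attached to $\delta^Y$. **Forms.** For a smooth scheme $Y$ over $A$ (and likewise for a $p$-adic formal scheme), $\Omega_{\widehat Y}=\varprojlim_n\Omega_{Y_n/A_n}$ with $A_n=A/p^nA$, $Y_n=Y\otimes A_n$, and $\Omega^i_{\widehat Y}=\wedge^i\Omega_{\widehat Y}$. For a Frobenius lift $\phi$ on $\widehat Y$, the pull-back $\phi^*$ on $1$-forms is divisible by $p$, giving $\frac{\phi^*}{p}:\Omega^1_{\widehat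 Y}\to\Omega^1_{\widehat Y}$. **$p$-jet spaces.** For an affine scheme $Y=\operatorname{Spec} A[x]/(f)$ of finite type ($x$, $f$ tuples), $$J^n(Y)=\operatorname{Spf} A[x,x',\dots,x^{(n)}]^{\widehat{\ }}/(f,\delta f,\dots,\delta^n f),$$ where $x',\dots,x^{(n)}$ are new tuples of indeterminates and $\delta=\delta^{\mathrm{univ}}$ is the unique $p$-derivation on $A[x,x',x'',\dots]$ extending $\delta^A$ with $\delta x^{(i)}=x^{(i+1)}$. For general $Y$, $J^n(Y)$ is obtained by gluing. The $J^n(Y)$ form a projective system functorial in $Y$, with $J^0(Y)=\widehat Y$; functions and forms on $J^{n}(Y)$ are viewed on $J^{n+1}(Y)$ by pull-back. The ring homomorphisms $\phi^{\mathrm{univ}}:\mathcal{O}(J^n(Y))\to\mathcal{O}(J^{n+1}(Y))$, $b\mapsto b^p+p\,\delta^{\mathrm{univ}}b$ (and their sheaf versions), induce maps $\frac{\phi^{\mathrm{univ}*}}{p}:\Omega_{J^n(Y)}\to\Omega_{J^{n+1}(Y)}$. If $Y$ is a group scheme, $J^n(Y)$ is a group in the category of $p$-adic formal schemes. **Euler setting.** Let $a_1,a_2,a_3\in A$ with $(a_1-a_2)(a_2-a_3)(a_3-a_1)\in A^\times$. Put $H_1=\sum_{i=1}^3 a_ix_i^2$ and $H_2=\sum_{i=1}^3x_i^2$ in $A[x_1,x_2,x_3]$, and $$N(z_1,z_2)=\prod_{i=1}^3(z_1-a_iz_2)\in A[z_1,z_2].$$ Let $$F=((a_2-a_3)x^2+z_1-a_2z_2)((a_3-a_1)x^2-z_1+a_1z_2)\in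 A[z_1,z_2][x],$$ and let $A_{p-1}\in A[z_1,z_2]$ (the Hasse invariant) be the coefficient of $x^{p-1}$ in $F^{\frac{p-1}{2}}$. Put $$Q=x_1x_2\cdot N(H_1,H_2)\cdot A_{p-1}(H_1,H_2),\qquad X=\operatorname{Spec}A[x_1,x_2,x_3][1/Q]\subset\mathbb{A}^3.$$ **The curves $E_c$, $\mathcal{E}_c$.** For $c=(c_1,c_2)\in A^2$ let $E_c=\operatorname{Spec}A[x_1,x_2,x_3]/(H_1-c_1,H_2-c_2)$ and $E_c^0=E_c\cap X$. If $N(c_1,c_2)\in A^\times$, then $E_c$ is smooth over $A$; $\mathcal{E}_c$ denotes its smooth projective model over $A$ (the intersection of the two quadrics $\sum a_ix_i^2=c_1x_0^2$, $\sum x_i^2=c_2x_0^2$ in $\mathbb{P}^3_A$), a genus one curve regarded as an elliptic curve by choosing an $A$-point as origin. The restrictions to $E_c$ of $$\frac{dx_1}{(a_2-a_3)x_2x_3},\quad\frac{dx_2}{(a_3-a_1)x_3x_1},\quad\frac{dx_3}{(a_1-a_2)x_1x_2}$$ glue to a global $1$-form $\omega_c$ on $E_c$, which extends to an invertible $1$-form on $\mathcal{E}_c$; the extension and its restriction to $E^0_c$ are also denoted $\omega_c$. If $\delta^XH_1=\delta^XH_2=0$ and $\delta^Ac_1=\delta^Ac_2=0$, then $\phi^X$ induces a Frobenius lift on $\widehat{E^0_c}$, denoted $\phi_c$. **The section $\sigma_c^2$.** Let $\delta_c$ be the $p$-derivation on $\mathcal{O}(\widehat{E^0_c})$ attached to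 $\phi_c$, i.e. $\phi_c(b)=b^p+p\,\delta_cb$. The section $\sigma^2_c:\widehat{E^0_c}\to J^2(E^0_c)$ of the projection $J^2(E^0_c)\to\widehat{E^0_c}$ is the one given on coordinates by $x\mapsto x$, $x'\mapsto\delta_cx$, $x''\mapsto\delta_c^2x$. For $\psi\in\mathcal{O}(J^2(\mathcal{E}_c))$, $\sigma_c^{2*}\psi\in\mathcal{O}(\widehat{E^0_c})$ is the pull-back of the restriction of $\psi$ to $J^2(E^0_c)$; its image in $K_c$ is its reduction mod $p$, a regular function on the open set $E^0_c\otimes k$ of $\mathcal{E}_c\otimes k$. **Canonical $\delta$-character.** For an elliptic curve $\mathcal{E}$ over $A$ admitting no Frobenius lift, there is a non-zero homomorphism $\psi:J^2(\mathcal{E})\to\widehat{\mathbb{G}_a}$ of groups in the category of $p$-adic formal schemes, unique up to multiplication by an element of $A^\times$ (known theorem); it is viewed as an element of $\mathcal{O}(J^2(\mathcal{E}))$. Given an invertible $1$-form $\omega$ on $\mathcal{E}$, one can write, in $\Omega_{J^2(\mathcal{E})}$, $$d\psi=\lambda_2\Big(\frac{\phi^{\mathrm{univ}*}}{p}\Big)^2\omega+\lambda_1\frac{\phi^{\mathrm{univ}*}}{p}\omega+\lambda_0\omega,\qquad\lambda_i\in A,$$ and the canonical $\delta$-character (normalized with respect to $\omega$) is the $\psi$ for which $\lambda_2=p$. *)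

(* Defs.v *)
From HB Require Import structures.
From mathcomp Require Import all_boot all_order all_algebra.
From mathcomp Require Import boolp classical_sets mpoly.

Set Implicit Arguments.
Unset Strict Implicit.
Unset Printing Implicit Defensive.

Import GRing.Theory.
Local Open Scope ring_scope.
Local Open Scope quotient_scope.

(** [clim F] is the inverse limit of the quotients V / F_n, for a decreasing
   chain F of subgroups of V.  It is realized as the quotient of the sequences
   b with b_(n+1) = b_n mod F_n, by the relation b_n = b'_n mod F_n for all n. *)

Record filt (V : zmodType) := Filt {
  fmem :> nat -> V -> Prop;
  filt0 : forall n, fmem n 0;
  filtB : forall n x y, fmem n x -> fmem n y -> fmem n (x - y);
  filtS : forall n x, fmem n.+1 x -> fmem n x }.

Definition coherent (V : zmodType) (F : filt V) (b : nat -> V) :=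
  forall n, F n (b n.+1 - b n).

Record cseq (V : zmodType) (F : filt V) := Cseq {
  cval : nat -> V;
  cvalP : coherent F cval }.

Section CseqInst.
Variables (V : zmodType) (F : filt V).
HB.instance Definition _ := gen_eqMixin (cseq F).
HB.instance Definition _ := gen_choiceMixin (cseq F).
End CseqInst.

Section Clim.
Variables (V : zmodType) (F : filt V).
Implicit Types (x y z : V) (b : nat -> V).

Lemma filtN n x : F n x -> F n (- x).
Proof. by move=> Fx; rewrite -[- x]add0r; apply: filtB (filt0 F n) Fx. Qed.

Lemma filtD n x y : F n x -> F n y -> F n (x + y).
Proof. by move=> Fx Fy; rewrite -[y]opprK; apply: filtB Fx (filtN Fy). Qed.

Definition ceq (b b' : cseq F) : bool :=
  `[< forall n, F n (cval b n - cval b' n) >].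

Lemma ceqP : equiv_class_of ceq.
Proof.
split=> [b|b b'|b2 b1 b3].
- by apply/asboolP => n; rewrite subrr; apply: filt0.
- by apply/asboolP/asboolP => H n; rewrite -opprB; apply: filtN.
- move=> /asboolP H /asboolP K; apply/asboolP => n.
  by rewrite -(subrKA (cval b2 n)); apply: filtD.
Qed.

Canonical ceq_equiv := EquivRelPack ceqP.

Definition clim := {eq_quot ceq}.
HB.instance Definition _ : EqQuotient _ ceq clim := EqQuotient.on clim.
HB.instance Definition _ := Choice.on clim.

Lemma coherent0 : coherent F (fun _ => 0).
Proof. by move=> n; rewrite subrr; apply: filt0. Qed.

(* The class of a sequence; the value is meaningful only on coherent ones. *)
Definition cls (b : nat -> V) : clim :=
  if pselect (coherent F b) is left h then \pi_clim (Cseq h)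
  else \pi_clim (Cseq coherent0).

Definition rep (x : clim) : nat -> V := cval (repr x).

Definition capprox (x : clim) b := forall n, F n (rep x n - b n).

Lemma rep_coh (x : clim) : coherent F (rep x).
Proof. exact: cvalP. Qed.

Lemma cls_approx b : coherent F b -> capprox (cls b) b.
Proof.
move=> hb n; rewrite /cls; case: pselect => // h.
rewrite /rep; case: piP => c /eqmodP /= /asboolP /(_ n) /= H.
by rewrite -opprB; apply: filtN.
Qed.

Lemma capprox_rep (x : clim) : capprox x (rep x).
Proof. by move=> n; rewrite subrr; apply: filt0. Qed.

Lemma capprox_eq (x y : clim) b : capprox x b -> capprox y b -> x = y.
Proof.
move=> hx hy; rewrite -[x]reprK -[y]reprK; apply/eqmodP/asboolP => n.
by rewrite -(subrKA (b n)); apply: filtD (hx n) _; rewrite -opprB; apply: filtN.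
Qed.

Lemma eq_capprox (x : clim) b b' : b =1 b' -> capprox x b -> capprox x b'.
Proof. by move=> e h n; rewrite -e. Qed.

Lemma coherentD b b' :
  coherent F b -> coherent F b' -> coherent F (fun n => b n + b' n).
Proof. by move=> h h' n; rewrite opprD addrACA; apply: filtD. Qed.

Lemma coherentN b : coherent F b -> coherent F (fun n => - b n).
Proof. by move=> h n; rewrite -opprD; apply: filtN. Qed.

Definition clim0 : clim := cls (fun _ => 0).
Definition climN (x : clim) : clim := cls (fun n => - rep x n).
Definition climD (x y : clim) : clim := cls (fun n => rep x n + rep y n).

Lemma clim0_approx : capprox clim0 (fun _ => 0).
Proof. exact: cls_approx coherent0. Qed.

Lemma climN_approx (x : clim) b : capprox x b -> capprox (climN x) (fun n => - b n).
Proof.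
move=> h n; rewrite -(subrKA (- rep x n)).
apply: filtD; first exact: (cls_approx (coherentN (rep_coh x))).
by rewrite -opprD; apply: filtN.
Qed.

Lemma climD_approx (x y : clim) b b' : capprox x b -> capprox y b' ->
  capprox (climD x y) (fun n => b n + b' n).
Proof.
move=> h h' n; rewrite -(subrKA (rep x n + rep y n)).
apply: filtD; first exact: (cls_approx (coherentD (rep_coh x) (rep_coh y))).
by rewrite opprD addrACA; apply: filtD.
Qed.

Lemma climDA : associative climD.
Proof.
move=> x y z; apply: (@capprox_eq _ _ (fun n => rep x n + (rep y n + rep z n))).
  by do 2?[apply: climD_approx]; apply: capprox_rep.
apply: eq_capprox (fun n => esym (addrA _ _ _)) _.
by do 2?[apply: climD_approx]; apply: capprox_rep.
Qed.

Lemma climDC : commutative climD.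
Proof.
move=> x y; apply: (@capprox_eq _ _ (fun n => rep x n + rep y n)).
  by apply: climD_approx; apply: capprox_rep.
apply: eq_capprox (fun n => addrC _ _) _.
by apply: climD_approx; apply: capprox_rep.
Qed.

Lemma clim0D : left_id clim0 climD.
Proof.
move=> x; apply: (@capprox_eq _ _ (rep x)); last exact: capprox_rep.
apply: eq_capprox (fun n => add0r _) _.
exact: climD_approx clim0_approx (capprox_rep x).
Qed.

Lemma climND : left_inverse clim0 climN climD.
Proof.
move=> x; apply: capprox_eq clim0_approx.
apply: eq_capprox (fun n => addNr (rep x n)) _.
by apply: climD_approx; first apply: climN_approx; apply: capprox_rep.
Qed.

HB.instance Definition _ := GRing.isZmodule.Build clim climDA climDC clim0D climND.

End Clim.

Record ifilt (R : comNzRingType) := Ifilt {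
  ifilt_filt :> filt R;
  ifiltM : forall n a x, ifilt_filt n x -> ifilt_filt n (a * x) }.

Definition rlim (R : comNzRingType) (F : ifilt R) := clim F.

Section Rlim.
Variables (R : comNzRingType) (F : ifilt R).
Implicit Types (x y z : rlim F) (b : nat -> R).

HB.instance Definition _ := GRing.Zmodule.on (rlim F).

Definition rlim1 : rlim F := cls F (fun _ => 1).
Definition rlimM (x y : rlim F) : rlim F := cls F (fun n => rep x n * rep y n).

Lemma ifiltM2 n (u v u' v' : R) :
  F n (u - u') -> F n (v - v') -> F n (u * v - u' * v').
Proof.
move=> h h'; rewrite -(subrKA (u * v')) -mulrBr -mulrBl.
by apply: filtD; [|rewrite mulrC]; apply: ifiltM.
Qed.

Lemma rlim1_approx : capprox rlim1 (fun _ => 1).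
Proof. by apply: cls_approx => n; rewrite subrr; apply: filt0. Qed.

Lemma rlimM_approx x y b b' : capprox x b -> capprox y b' ->
  capprox (rlimM x y) (fun n => b n * b' n).
Proof.
move=> h h' n; rewrite -(subrKA (rep x n * rep y n)).
apply: filtD; last exact: ifiltM2.
by apply: cls_approx => m; apply: ifiltM2; apply: rep_coh.
Qed.

Lemma rlimMA : associative rlimM.
Proof.
move=> x y z; apply: (@capprox_eq _ _ _ _ (fun n => rep x n * (rep y n * rep z n))).
  by do 2?[apply: rlimM_approx]; apply: capprox_rep.
apply: eq_capprox (fun n => esym (mulrA _ _ _)) _.
by do 2?[apply: rlimM_approx]; apply: capprox_rep.
Qed.

Lemma rlimMC : commutative rlimM.
Proof.
move=> x y; apply: (@capprox_eq _ _ _ _ (fun n => rep x n * rep y n)).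
  by apply: rlimM_approx; apply: capprox_rep.
apply: eq_capprox (fun n => mulrC _ _) _.
by apply: rlimM_approx; apply: capprox_rep.
Qed.

Lemma rlim1M : left_id rlim1 rlimM.
Proof.
move=> x; apply: (@capprox_eq _ _ _ _ (rep x)); last exact: capprox_rep.
apply: eq_capprox (fun n => mul1r _) _.
exact: rlimM_approx rlim1_approx (capprox_rep x).
Qed.

Lemma rlimMDl : left_distributive rlimM +%R.
Proof.
move=> x y z.
apply: (@capprox_eq _ _ _ _ (fun n => (rep x n + rep y n) * rep z n)).
  by apply: rlimM_approx; [apply: climD_approx|]; apply: capprox_rep.
apply: eq_capprox (fun n => esym (mulrDl _ _ _)) _.
by apply: climD_approx; apply: rlimM_approx; apply: capprox_rep.
Qed.

HB.instance Definition _ :=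
  GRing.Zmodule_isComPzRing.Build (rlim F) rlimMA rlimMC rlim1M rlimMDl.

End Rlim.

Definition in_ideal (R : comNzRingType) (G : seq R) (f : R) : Prop :=
  exists c : 'I_(size G) -> R, f = \sum_i c i * G`_i.

Section Ideal.
Variables (R : comNzRingType).
Implicit Types (G : seq R) (f g : R).

Lemma in_ideal0 G : in_ideal G 0.
Proof. by exists (fun _ => 0); rewrite big1 // => i _; rewrite mul0r. Qed.

Lemma in_idealB G f g : in_ideal G f -> in_ideal G g -> in_ideal G (f - g).
Proof.
move=> [c ->] [d ->]; exists (fun i => c i - d i).
by rewrite -sumrB; apply: eq_bigr => i _; rewrite mulrBl.
Qed.

Lemma in_idealM G a f : in_ideal G f -> in_ideal G (a * f).
Proof.
move=> [c ->]; exists (fun i => a * c i).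
by rewrite mulr_sumr; apply: eq_bigr => i _; rewrite mulrA.
Qed.

Lemma in_ideal_pexpS p G n f :
  in_ideal (p%:R ^+ n.+1 :: G) f -> in_ideal (p%:R ^+ n :: G) f.
Proof.
move=> [c ->].
exists (fun i => c i * (if i == ord0 :> 'I_(size G).+1 then p%:R else 1)).
rewrite !big_ord_recl /= exprS mulrA; congr (_ + _).
by apply: eq_bigr => i _; rewrite mulr1.
Qed.

Definition adic_filt (p : nat) G : filt R :=
  @Filt R (fun n => in_ideal (p%:R ^+ n :: G))
    (fun n => in_ideal0 _) (fun n => @in_idealB _) (fun n => @in_ideal_pexpS p G n).

(* (p^n, G), so that [rlim (adic_ifilt p G)] is the p-adic completion of R/(G) *)
Definition adic_ifilt (p : nat) G : ifilt R :=
  @Ifilt R (adic_filt p G) (fun n => @in_idealM _).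

End Ideal.

(** For P = A[y_0, .., y_(m-1)], a form sum_k w_k dy_k is the row vector w.
   Omega of P/(p^n, G) is the quotient of P^m by (p^n, G) P^m + sum_(g in G) P dg. *)

Section Forms.
Variables (A : comNzRingType) (m : nat) (p : nat).
Local Notation P := {mpoly A[m]}.

Definition grad (f : P) : 'rV[P]_m := \row_k f^`M(k).

Definition in_forms (G : seq P) (n : nat) (w : 'rV[P]_m) : Prop :=
  exists c : 'I_(size G) -> P,
  forall k, in_ideal (p%:R ^+ n :: G) ((w - \sum_i c i *: grad G`_i) 0 k).

Lemma in_forms0 G n : in_forms G n 0.
Proof.
exists (fun _ => 0) => k; rewrite big1 => [|i _]; last by rewrite scale0r.
by rewrite subr0 mxE; apply: in_ideal0.
Qed.

Lemma in_formsB G n w w' :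
  in_forms G n w -> in_forms G n w' -> in_forms G n (w - w').
Proof.
move=> [c h] [c' h']; exists (fun i => c i - c' i) => k.
rewrite (eq_bigr _ (fun i _ => scalerBl _ _ _)) sumrB.
suff -> : w - w' - (\sum_i c i *: grad G`_i - \sum_i c' i *: grad G`_i) =
  (w - \sum_i c i *: grad G`_i) - (w' - \sum_i c' i *: grad G`_i).
  by rewrite mxE [(- (w' - _)) _ _]mxE; apply: in_idealB.
by rewrite !opprB -!addrA; congr (_ + _); rewrite addrCA [RHS]addrC -!addrA [- w' + _]addrC.
Qed.

Lemma in_formsS G n w : in_forms G n.+1 w -> in_forms G n w.
Proof. by move=> [c h]; exists c => k; apply: in_ideal_pexpS (h k). Qed.

Definition form_filt (G : seq P) : filt 'rV[P]_m :=
  Filt (in_forms0 G) (@in_formsB G) (@in_formsS G).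

End Forms.

Definition pmul (p : nat) (R : pzRingType) (n : nat) (x : R) : Prop :=
  exists y : R, x = p%:R ^+ n * y.

Definition cdvr (p : nat) (A : idomainType) : Prop :=
  [/\ (p%:R : A) != 0, (p%:R : A) \isn't a GRing.unit,
      forall x : A, x != 0 ->
        exists u n, u \is a GRing.unit /\ x = u * p%:R ^+ n
    & forall s : nat -> A, (forall n, pmul p n (s n.+1 - s n)) ->
        exists l, forall n, pmul p n (l - s n)].

Definition residue_field (p : nat) (A : pzRingType) (k : fieldType)
    (red : {rmorphism A -> k}) : Prop :=
  (forall y, exists x, red x = y) /\ (forall x, red x = 0 <-> pmul p 1 x).

(* Z_p is the p-adic closure of Z in A. *)
Definition in_Zp (p : nat) (A : pzRingType) (x : A) : Prop :=
  forall n, exists z : int, pmul p n (x - z%:~R).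

Definition frob (p : nat) (R : pzSemiRingType) (d : R -> R) (b : R) : R :=
  b ^+ p + p%:R * d b.

(* For p-torsion free R *)
Definition p_derivation (p : nat) (R : pzRingType) (d : R -> R) : Prop :=
  zmod_morphism (frob p d) /\ monoid_morphism (frob p d).

(** [Aff n f] is Spec A[x_0, .., x_(n-1)]/(f).  A morphism T -> S is given by a
   tuple g of polynomials in the coordinates of T. *)

Record affine (A : nzRingType) := Aff {
  nv : nat;
  eqs : seq {mpoly A[nv]} }.

Definition subst (A : nzRingType) (n m : nat) (g : 'I_n -> {mpoly A[m]}) :
  {mpoly A[n]} -> {mpoly A[m]} := mmap (@mpolyC m A) g.

Definition is_mor (A : comNzRingType) (T S : affine A)
    (g : 'I_(nv S) -> {mpoly A[nv T]}) : Prop :=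
  forall f, f \in eqs S -> in_ideal (eqs T) (subst g f).

(* The open subscheme q <> 0; the last variable is the inverse of q. *)
Definition loc (A : nzRingType) (S : affine A) (q : {mpoly A[nv S]}) : affine A :=
  @Aff A (nv S).+1 (rcons (map (@mwiden _ _) (eqs S)) ('X_ord_max * mwiden q - 1)).

(** [{mpoly A[jdim n r]}] is A[x, x', .., x^(r)] for an n-tuple x; the variables
   are numbered so that x_i^(j) has index j * n + i, whence
   delta y_k = y_(n+k). *)

Fixpoint jdim (n r : nat) : nat := if r is r'.+1 then (n + jdim n r')%N else n.

Definition jwid (n r : nat) : 'I_(jdim n r) -> 'I_(jdim n r.+1) :=
  widen_ord (leq_addl n (jdim n r)).

Definition jshift (n r : nat) : 'I_(jdim n r) -> 'I_(jdim n r.+1) :=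
  @rshift n (jdim n r).

Section Jets.
Variables (p : nat) (A : comNzRingType) (dA : A -> A).

Section Univ.
Variable n : nat.
Local Notation P r := {mpoly A[jdim n r]}.

Definition jincl (r : nat) : P r -> P r.+1 := subst (fun k => 'X_(jwid k)).

Definition phi_univ (r : nat) : P r -> P r.+1 :=
  mmap (fun x : A => (frob p dA x)%:MP)
       (fun k => 'X_(jwid k) ^+ p + p%:R * 'X_(jshift k)).

Definition del_univ (r : nat) (f : P r) : P r.+1 :=
  xget 0 [set g | p%:R * g = phi_univ f - jincl f ^+ p]%classic.

Fixpoint incl_iter (r : nat) (f : {mpoly A[n]}) : P r :=
  if r is r'.+1 then jincl (incl_iter r' f) else f.

Fixpoint del_iter (r : nat) (f : {mpoly A[n]}) : P r :=
  if r is r'.+1 then del_univ (del_iter r' f) else f.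

End Univ.

(* f, delta f, .., delta^r f *)
Fixpoint jeqs (r : nat) (S : affine A) : seq {mpoly A[jdim (nv S) r]} :=
  if r is r'.+1
  then map (@jincl _ r') (jeqs r' S) ++ map (@del_iter _ r'.+1) (eqs S)
  else eqs S.

(* O(J^r(S)); in particular [J 0 S] is O of the p-adic completion of S. *)
Definition J (r : nat) (S : affine A) : comPzRingType :=
  rlim (adic_ifilt p (jeqs r S)).

(* The global sections of Omega on J^r(S), relative to A. *)
Definition Om (r : nat) (S : affine A) : zmodType :=
  clim (form_filt p (jeqs r S)).

Section Ops.
Variables (r : nat) (S : affine A).

Definition jof (f : {mpoly A[jdim (nv S) r]}) : J r S := cls _ (fun _ => f).
Definition jX (k : 'I_(jdim (nv S) r)) : J r S := jof 'X_k.
Definition jC (x : A) : J r S := jof x%:MP.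

Definition dJ (b : J r S) : Om r S := cls _ (fun n => grad (rep b n)).

Definition jscale (b : J r S) (w : Om r S) : Om r S :=
  cls _ (fun n => rep b n *: rep w n).

Definition ascale (x : A) (w : Om r S) : Om r S := jscale (jC x) w.

(* phi^univ* / p: it maps b dy to phi(b) (y^(p-1) dy + d(delta y)), because
   d(phi y) = d(y^p + p delta y). *)
Definition phi_form (w : Om r S) : Om r.+1 S :=
  cls _ (fun n => \sum_k phi_univ (rep w n 0 k) *:
           ('X_(jwid k) ^+ p.-1 *: grad 'X_(jwid k) + grad 'X_(jshift k))).

End Ops.

(* Pull-back of functions and forms by the morphism J^q(T) -> J^r(S) given on
   coordinates by v. *)
Section Pull.
Variables (r q : nat) (S T : affine A) (v : 'I_(jdim (nv S) r) -> J q T).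

Definition pull (b : J r S) : J q T :=
  cls _ (fun n => subst (fun k => rep (v k) n) (rep b n)).

Definition pull_form (w : Om r S) : Om q T :=
  cls _ (fun n => \sum_k subst (fun k => rep (v k) n) (rep w n 0 k) *:
                    grad (rep (v k) n)).

End Pull.

Definition incl_form (r : nat) (S : affine A) : Om r S -> Om r.+1 S :=
  pull_form (fun k => @jX r.+1 S (jwid k)).

(* Coordinates of J^r(g) : J^r(T) -> J^r(S) for a morphism g : T -> S. *)
Fixpoint jcoord (n m r : nat) (g : 'I_n -> {mpoly A[m]}) :
    'I_(jdim n r) -> {mpoly A[jdim m r]} :=
  if r is r'.+1 then fun k : 'I_(n + jdim n r') =>
    match split k with
    | inl i => incl_iter r'.+1 (g i)
    | inr l => del_univ (@jcoord n m r' g l)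
    end
  else g.

Definition Jmap (r : nat) (T S : affine A) (g : 'I_(nv S) -> {mpoly A[nv T]}) :
  J r S -> J r T := pull (fun k => jof (jcoord g k)).

Definition Jmap_form (r : nat) (T S : affine A)
  (g : 'I_(nv S) -> {mpoly A[nv T]}) :
  Om r S -> Om r T := pull_form (fun k => jof (jcoord g k)).

(* Coordinates of the section sigma^r : x^(j) |-> d^j x, for a p-derivation d
   on the completion of S. *)
Fixpoint sig (S : affine A) (d : J 0 S -> J 0 S) (r : nat) :
    'I_(jdim (nv S) r) -> J 0 S :=
  if r is r'.+1 then fun k : 'I_(nv S + jdim (nv S) r') =>
    match split k with
    | inl i => @jX 0 S i
    | inr l => d (@sig S d r' l)
    end
  else @jX 0 S.

Definition sig_pull (S : affine A) (d : J 0 S -> J 0 S) (r : nat) :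
  J r S -> J 0 S := pull (@sig S d r).

(* phi* / p for phi = frob d on the completion of S; one has
   phi = sigma^1* o phi^univ. *)
Definition frob_form (S : affine A) (d : J 0 S -> J 0 S) (w : Om 0 S) : Om 0 S :=
  pull_form (@sig S d 1) (phi_form w).

(* A delta^A-flow on the p-adic completion of S.  A p-derivation extends uniquely
   to completed localizations, so on an affine formal scheme a flow is the same
   thing as a p-derivation on global sections. *)
Definition flow (S : affine A) (d : J 0 S -> J 0 S) : Prop :=
  p_derivation p d /\ forall x, frob p d (jC 0 S x) = jC 0 S (frob p dA x).

End Jets.

(** A point of P^3 over S = Spec R is a rank one direct summand L of R^4, which we
   give by a matrix over R with row space L, of trace 1 and with vanishing 2x2
   minors (such a matrix is idempotent, and its i-th row generates L where its
   i-th diagonal entry is invertible).  Matrices are taken with polynomial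
   entries, modulo the ideal of S. *)

Definition pmat (A : nzRingType) (S : affine A) := 'M[{mpoly A[nv S]}]_4.

Definition same_pt (A : comNzRingType) (S : affine A) (M M' : pmat S) : Prop :=
  forall i j k l, in_ideal (eqs S) (M i j * M' k l - M i l * M' k j).

Section Projective.
Variables (A : comNzRingType).

Section Curve.
Variables (a : 'I_3 -> A) (c : 'I_2 -> A).

(* The points of the curve sum a_i x_i^2 = c_1 x_0^2, sum x_i^2 = c_2 x_0^2. *)
Definition is_pt (S : affine A) (M : pmat S) : Prop :=
  [/\ in_ideal (eqs S) (\tr M - 1),
      same_pt M M,
      forall i, in_ideal (eqs S)
        (\sum_j a j *: M i (lift ord0 j) ^+ 2 - c 0 *: M i ord0 ^+ 2)
    & forall i, in_ideal (eqs S)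
        (\sum_j M i (lift ord0 j) ^+ 2 - c 1 *: M i ord0 ^+ 2)].

(* P' over T is the pull-back of P over S by g : T -> S. *)
Definition pt_pull (T S : affine A) (g : 'I_(nv S) -> {mpoly A[nv T]})
    (P : pmat S) (P' : pmat T) : Prop :=
  [/\ is_mor g, is_pt P, is_pt P' & same_pt P' (map_mx (subst g) P)].

(* The structure of a group scheme, i.e. a group structure on the functor of
   points; equality of points is [same_pt], and the neutral element is an
   arbitrary A-point. *)
Definition group_law (add : forall S : affine A, pmat S -> pmat S -> pmat S)
    (opp : forall S : affine A, pmat S -> pmat S)
    (zero : forall S : affine A, pmat S) : Prop :=
  [/\ [/\ forall S P P', is_pt P -> is_pt P' -> is_pt (add S P P'),
          forall S P, is_pt P -> is_pt (opp S P)
        & forall S, is_pt (zero S)],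
      [/\ forall T S g P P' Q Q', @pt_pull T S g P P' -> pt_pull g Q Q' ->
            pt_pull g (add S P Q) (add T P' Q'),
          forall T S g P P', @pt_pull T S g P P' -> pt_pull g (opp S P) (opp T P')
        & forall T S g, @is_mor A T S g -> pt_pull g (zero S) (zero T)]
    & [/\ forall S P Q R, is_pt P -> is_pt Q -> is_pt R ->
            same_pt (add S P (add S Q R)) (add S (add S P Q) R),
          forall S P, is_pt P -> same_pt (add S (zero S) P) P,
          forall S P, is_pt P -> same_pt (add S P (zero S)) P,
          forall S P, is_pt P -> same_pt (add S (opp S P) P) (zero S)
        & forall S P, is_pt P -> same_pt (add S P (opp S P)) (zero S)]].

Variables (p : nat) (dA : A -> A).

(* Functions on J^r(E): compatible families of functions on J^r(S), for all
   S -> E with S affine.  Taking g = id, the value depends only on the point. *)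
Definition is_fun (r : nat) (psi : forall S : affine A, pmat S -> J p dA r S) :=
  forall T S g P P', @pt_pull T S g P P' -> psi T P' = Jmap g (psi S P).

Definition is_form (w : forall S : affine A, pmat S -> Om p dA 0 S) :=
  forall T S g P P', @pt_pull T S g P P' -> w T P' = Jmap_form g (w S P).

Definition canonical_character
    (add : forall S : affine A, pmat S -> pmat S -> pmat S)
    (w : forall S : affine A, pmat S -> Om p dA 0 S)
    (psi : forall S : affine A, pmat S -> J p dA 2 S) : Prop :=
  [/\ is_fun psi,
      forall S P Q, is_pt P -> is_pt Q ->
        psi S (add S P Q) = psi S P + psi S Q
    & exists l1 l0 : A, forall S P, is_pt P ->
        dJ (psi S P) =
          ascale p%:R (phi_form (phi_form (w S P)))
          + ascale l1 (incl_form (phi_form (w S P)))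
          + ascale l0 (incl_form (incl_form (w S P)))].

End Curve.

(* A Frobenius lift on E, i.e. an A-morphism from E to its twist by phi^A which
   on points over rings with p = 0 raises coordinates to the p-th power. *)
Definition has_frobenius_lift (p : nat) (dA : A -> A)
    (a : 'I_3 -> A) (c : 'I_2 -> A) : Prop :=
  exists Fr : forall S : affine A, pmat S -> pmat S,
    (forall T S g P P', @pt_pull a c T S g P P' ->
       pt_pull (fun i => frob p dA (a i)) (fun i => frob p dA (c i)) g
         (Fr S P) (Fr T P'))
    /\ (forall S P, is_pt a c P -> in_ideal (eqs S) p%:R ->
          same_pt (Fr S P) (map_mx (fun f => f ^+ p) P)).

Definition aff_pt (S : affine A) (x : 'I_3 -> {mpoly A[nv S]}) : pmat S :=
  \matrix_(i, j) if i == ord0 then oapp x 1 (unlift ord0 j) else 0.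

End Projective.

(** The indices 1, 2, 3 are shifted to 0, 1, 2. *)

Section Euler.
Variables (A : comNzRingType) (p : nat) (a : 'I_3 -> A).

Definition H1 : {mpoly A[3]} := \sum_i a i *: 'X_i ^+ 2.
Definition H2 : {mpoly A[3]} := \sum_i 'X_i ^+ 2.

Definition Npol : {mpoly A[2]} := \prod_i ('X_0 - a i *: 'X_1).

Definition Fpol : {poly {mpoly A[2]}} :=
  ((a 1 - a 2)%:MP *: 'X^2 + ('X_0 - a 1 *: 'X_1)%:P)
  * ((a 2 - a 0)%:MP *: 'X^2 + (- 'X_0 + a 0 *: 'X_1)%:P).

Definition hasse : {mpoly A[2]} := (Fpol ^+ (p.-1)./2)`_p.-1.

Definition Qpol : {mpoly A[3]} :=
  'X_0 * 'X_1 * (Npol \mPo [tuple H1; H2]) * (hasse \mPo [tuple H1; H2]).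

Definition A3 : affine A := @Aff A 3 [::].
Definition X : affine A := @loc A A3 Qpol.

Section Fibre.
Variable c : 'I_2 -> A.

Definition Ec : affine A := @Aff A 3 [:: H1 - (c 0)%:MP; H2 - (c 1)%:MP].
Definition E0 : affine A := @loc A Ec Qpol.

Variable dA : A -> A.

(* The equations say dx_1/((a_2 - a_3) x_2 x_3) = w where x_2 x_3 is invertible,
   and cyclically; the indices are taken mod 3. *)
Definition is_omega (w : Om p dA 0 Ec) : Prop :=
  forall i : 'I_3,
    jscale (@jof p A dA 0 Ec
              ((a (i + 1) - a (i + 2)) *: ('X_(i + 1) * 'X_(i + 2)))) w
    = dJ (@jX p A dA 0 Ec i).

Definition omega0 (w : Om p dA 0 Ec) : Om p dA 0 E0 :=
  @pull_form p A dA 0 0 Ec E0 (fun i : 'I_3 => @jX p A dA 0 E0 (widen_ord (leqnSn 3) i)) w.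

(* Restriction of functions from X to E_c^0 (the same coordinates) *)
Definition resE0 : J p dA 0 X -> J p dA 0 E0 :=
  @pull p A dA 0 0 X E0 (fun k : 'I_4 => @jX p A dA 0 E0 k).

Definition induced (dX : J p dA 0 X -> J p dA 0 X)
    (dc : J p dA 0 E0 -> J p dA 0 E0) : Prop :=
  flow dc /\ forall b, frob p dc (resE0 b) = resE0 (frob p dX b).

Definition taut_pt : pmat E0 :=
  @aff_pt A E0 (fun i => 'X_(widen_ord (leqnSn 3) i)).

End Fibre.

End Euler.

(* K is the field of fractions of B/pB, with iota the canonical map.  For B the
   functions on a nonempty affine open of the completion of an integral scheme
   over A, K is the function field of the reduction mod p. *)
Definition is_frac_mod (p : nat) (B : comPzRingType) (K : fieldType)
    (iota : {rmorphism B -> K}) : Prop :=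
  (forall b, iota b = 0 <-> pmul p 1 b)
  /\ (forall z, exists b b', iota b' != 0 /\ z = iota b / iota b').

(* Main.v *)
(* Let f be the image of sigma^* psi in K and D the derivation of K dual to omega_c.
   Modulo p the term p (phi^* / p)^2 omega dies, so D f = m := l1 h + l0, where
   h = A_(p-1)(c)^(-1) comes from hypothesis (2).  One has K = K^p(x) with x = x_3:
   x_1 and x_2 are invertible and their squares are affine functions of x^2, and k is
   perfect.  Hence ker D = K^p, which settles the case m = 0.

   If m <> 0, then omega = dg with g = f / m.  Modulo p the operator phi^* / p depends
   only on the class of a form in the one-dimensional Omega_K, and it sends dg to
   g^(p-1) dg plus an exact form (it lifts the inverse Cartier operator).  By (2) it also
   sends omega to h omega, which is exact because h is constant.  So g^(p-1) dg would be
   exact, which is impossible since 1, g, .., g^(p-1) is a basis of K over K^p.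

   The section sigma is compatible with the relations of J^2 because the completion of
   O(E_c^0) is p-torsion free. *)

Require Import Defs.
From HB Require Import structures.
From mathcomp Require Import all_boot all_order all_algebra.
From mathcomp Require Import boolp classical_sets mpoly ring zify.

Set Implicit Arguments.
Unset Strict Implicit.
Unset Printing Implicit Defensive.

Import GRing.Theory.
Local Open Scope ring_scope.

(** * Derivations in characteristic p *)

(** Forms are elements of inverse limits, so Omega_K is not at hand. Instead every form on a jet
    space becomes an element of K: it is pulled back along sigma and contracted with D, and only its
    representative at level 1 matters. The one-dimensionality of Omega_K then turns into a statement
    on derivations. Contracting the divided Frobenius of df with D gives E(f) = f^(p-1) D f +
    D(delta f), a derivation along the Frobenius of K. It vanishes on p and on the equations, hence
    extends to K, and K = K^p(x) forces E(z) = rho (D z)^p for a single rho. Hypothesis (2),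
    contracted with D, says rho = h. Evaluated at f, this identity yields an explicit primitive of
    g^(p-1), namely h g - s / m^p, where s is the reduction of delta of a lift of f.
    Torsion-freeness is the price for sigma: the relations delta^j of an equation go to 0 only if
    division by p is unambiguous in the completion. It is derived from the regularity of p modulo
    the equations of E_c^0, before any completion. *)

Section TwistedDerivation.
Variables (R : comNzRingType) (K : fieldType).

(** These are the derivations of [R] into [K] seen as an [R]-module through [u]. Ordinary
    derivations have [u] the reduction map; the divided Frobenius gives one with [u] the reduction
    followed by Frobenius. *)
Definition twisted_der (u D : R -> K) :=
  (forall x y, D (x + y) = D x + D y) /\
  (forall x y, D (x * y) = u x * D y + u y * D x).

Variables (u : {rmorphism R -> K}) (D : R -> K).
Hypothesis hD : twisted_der u D.

Lemma twisted_der0 : D 0 = 0.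
Proof. by apply: (addrI (D 0)); rewrite -(proj1 hD) !addr0. Qed.

Lemma twisted_der1 : D 1 = 0.
Proof.
apply: (addrI (D 1)); rewrite addr0 -{3}(mulr1 1) (proj2 hD).
by rewrite rmorph1 !mul1r.
Qed.

Lemma twisted_derN x : D (- x) = - D x.
Proof. by apply: (addrI (D x)); rewrite -(proj1 hD) !subrr twisted_der0. Qed.

Lemma twisted_derB x y : D (x - y) = D x - D y.
Proof. by rewrite (proj1 hD) twisted_derN. Qed.

Lemma twisted_derX x n : D (x ^+ n) = u x ^+ n.-1 * D x *+ n.
Proof.
elim: n => [|n IH]; first by rewrite expr0 twisted_der1 mulr0n.
rewrite exprS (proj2 hD) {}IH rmorphXn /= mulrnAr mulrA -exprS mulrSr.
by case: n => [|n] //; rewrite !mulr0n.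
Qed.

End TwistedDerivation.

Section FractionDerivation.
Variables (R : comNzRingType) (K : fieldType).
Variables (i : {rmorphism R -> K}) (F : {rmorphism K -> K}) (D : R -> K).
Hypothesis hD : twisted_der (F \o i) D.
Hypothesis D_ker : forall x, i x = 0 -> D x = 0.
Hypothesis i_frac : forall z, exists x y, i y != 0 /\ z = i x / i y.

Let quot_rule x y := (F (i y) * D x - F (i x) * D y) / F (i y) ^+ 2.

Let quot_rule_eq x y x' y' : i y != 0 -> i y' != 0 ->
  i x / i y = i x' / i y' -> quot_rule x y = quot_rule x' y'.
Proof.
move=> y0 y0' e.
have Fy0 : F (i y) != 0 by rewrite fmorph_eq0.
have Fy0' : F (i y') != 0 by rewrite fmorph_eq0.
have /eqP e1 : i x * i y' == i x' * i y by rewrite -eqr_div // e.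
(* Equal fractions need not cross-multiply equally in [R], only modulo the kernel of [i]; [D_ker]
   bridges the gap. *)
have: D (x * y' - x' * y) = 0 by apply: D_ker; rewrite rmorphB !rmorphM /= e1 subrr.
rewrite (twisted_derB hD) !(proj2 hD) /= => e2.
have {}e1 : F (i x) = F (i x') * F (i y) / F (i y').
  by rewrite -rmorphM -e1 rmorphM mulfK.
have e3 : D x = (F (i x') * D y + F (i y) * D x' - F (i x) * D y') / F (i y').
  apply: (mulIf Fy0'); rewrite divfK //; apply/eqP; rewrite -subr_eq0; apply/eqP.
  by rewrite -[RHS]e2; ring.
by rewrite /quot_rule e3 e1; field; rewrite Fy0 Fy0'.
Qed.

(** The quotient rule twisted by [F] works because [D] factors through the image of [i], whose
    fractions exhaust [K]. *)
Lemma fraction_der : exists D' : K -> K,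
  twisted_der F D' /\ forall x, D' (i x) = D x.
Proof.
pose P z (xy : R * R) := i xy.2 != 0 /\ z = i xy.1 / i xy.2.
have /choice [s hs] : forall z, exists xy, P z xy.
  by move=> z; have [x [y h]] := i_frac z; exists (x, y).
pose D' z := quot_rule (s z).1 (s z).2.
have D'E x y : i y != 0 -> D' (i x / i y) = quot_rule x y.
  by move=> y0; have [h1 h2] := hs (i x / i y); apply: quot_rule_eq.
exists D'; split; last first.
  move=> x; have i1 : i 1 != 0 by rewrite rmorph1 oner_neq0.
  rewrite -[i x]divr1 -(rmorph1 i) D'E // /quot_rule (twisted_der1 hD).
  by rewrite !rmorph1 expr1n !divr1 mulr0 mul1r subr0.
split=> z w.
  have [x [y [y0 ->]]] := i_frac z; have [x' [y' [y0' ->]]] := i_frac w.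
  have Fy0 : F (i y) != 0 by rewrite fmorph_eq0.
  have Fy0' : F (i y') != 0 by rewrite fmorph_eq0.
  have -> : i x / i y + i x' / i y' = i (x * y' + x' * y) / i (y * y').
    by rewrite rmorphD !rmorphM /=; field; rewrite y0 y0'.
  rewrite !D'E ?rmorphM ?mulf_neq0 // /quot_rule (proj1 hD) !(proj2 hD) /=.
  by rewrite !(rmorphD, rmorphM) /=; field; rewrite Fy0 Fy0'.
have [x [y [y0 ->]]] := i_frac z; have [x' [y' [y0' ->]]] := i_frac w.
have Fy0 : F (i y) != 0 by rewrite fmorph_eq0.
have Fy0' : F (i y') != 0 by rewrite fmorph_eq0.
have -> : i x / i y * (i x' / i y') = i (x * x') / i (y * y').
  by rewrite !rmorphM /=; field; rewrite y0 y0'.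
rewrite !D'E ?rmorphM ?mulf_neq0 // /quot_rule !(proj2 hD) /=.
by rewrite !rmorphM /= ; field; rewrite Fy0 Fy0'.
Qed.

End FractionDerivation.

(** * Powers of an element x with D x nonzero as a basis of K over K^p *)

Section PBasis.
Variables (p : nat) (K : fieldType) (charK : p \in [pchar K]).
Local Notation Fr := (pFrobenius_aut charK).
Local Notation "q ^Fr" := (map_poly Fr q) (at level 2, format "q ^Fr").

Lemma twisted_der_pexp (F : {rmorphism K -> K}) (D : K -> K) x :
  twisted_der F D -> D (x ^+ p) = 0.
Proof. by move=> hD; rewrite (twisted_derX hD) -mulr_natr (pcharf0 charK) mulr0. Qed.

(** The coefficients of [q^Fr] are p-th powers, which every twisted derivation kills, so only [x]
    gets differentiated. A general [F] allows the use both for D and for the divided Frobenius. *)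
Lemma twisted_der_frob_horner (F : {rmorphism K -> K}) (D : K -> K) q x :
  twisted_der F D -> D (q^Fr).[x] = F (((q^`())^Fr).[x]) * D x.
Proof.
move=> hD; elim/poly_ind: q => [|q c IH].
  by rewrite deriv0 rmorph0 horner0 (twisted_der0 hD) rmorph0 mul0r.
rewrite derivD derivM derivX derivC mulr1 addr0.
rewrite !(rmorphD, rmorphM) /= map_polyX map_polyC /= !hornerE.
rewrite (proj1 hD) (proj2 hD) {}IH.
rewrite pFrobenius_autE (twisted_der_pexp _ hD).
by rewrite !(rmorphD, rmorphM) /=; ring.
Qed.

(** In degree below p, the integers multiplying the coefficients in the derivative are invertible in
    K. *)
Lemma deriv_eq0_small (q : {poly K}) :
  (size q <= p)%N -> q^`() = 0 -> q = (q`_0)%:P.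
Proof.
move=> sq e; apply/polyP => -[|j]; rewrite coefC //=.
have [lt|ge] := ltnP j.+1 p; last by rewrite nth_default // (leq_trans sq).
have := coef_deriv q j; rewrite e coef0 -mulr_natr => /esym/eqP.
rewrite mulf_eq0 => /orP[/eqP //|]; rewrite -(dvdn_pcharf charK) => /dvdn_leq.
by move=> /(_ isT); rewrite leqNgt lt.
Qed.

(** Differentiating a relation between 1, x, .., x^(p-1) over K^p gives a shorter one; by induction
    that one is trivial, so the relation was a constant. *)
Lemma frob_horner_eq0 (D : K -> K) x (q : {poly K}) : @twisted_der K K idfun D -> D x != 0 ->
  (size q <= p)%N -> (q^Fr).[x] = 0 -> q = 0.
Proof.
move=> hD Dx; move: {2}(size q) (leqnn (size q)) => n.
elim: n q => [|n IH] q sn sp e; first by apply/eqP; rewrite -size_poly_leq0.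
have q'0 : q^`() = 0.
  have [->|q0] := eqVneq q 0; first exact: deriv0.
  apply: IH; first by rewrite -ltnS (leq_trans (lt_size_deriv q0)).
    by rewrite (leq_trans (ltnW (lt_size_deriv q0))).
  apply: (mulIf Dx); rewrite mul0r -(twisted_der_frob_horner q x hD) e.
  exact: twisted_der0 hD.
move: e; rewrite (deriv_eq0_small sp q'0) map_polyC hornerC => /eqP.
by rewrite fmorph_eq0 => /eqP ->.
Qed.

Lemma frob_horner_small x q : exists2 q' : {poly K},
  (size q' <= p)%N & (q'^Fr).[x] = (q^Fr).[x].
Proof.
have p0 : (0 < p)%N by apply: prime_gt0; apply: pcharf_prime charK.
elim/poly_ind: q => [|q c [q' sq' e]]; first by exists 0; rewrite ?size_poly0.
(* The monomial of degree p, with coefficient b, is traded for the constant b x: Frobenius sends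
   this constant to b^p x^p, so the value at [x] is unchanged. *)
exists (q' * 'X + c%:P - q'`_p.-1 *: 'X^p + (q'`_p.-1 * x)%:P).
  apply/leq_sizeP => j lt; rewrite !coefD coefN coefZ coefXn !coefC coefMX.
  have -> : (j == 0%N) = false by apply/negbTE; rewrite -lt0n (leq_trans p0).
  rewrite !addr0; have [->|ne] := eqVneq j p; first by rewrite mulr1 subrr.
  rewrite mulr0 subr0 nth_default // (leq_trans sq') // -ltnS prednK //.
    by rewrite ltn_neqAle eq_sym ne.
  exact: leq_trans p0 lt.
rewrite !(rmorphD, rmorphN, rmorphM) /= map_polyX map_polyZ /= map_polyXn.
rewrite !map_polyC /= !hornerE e !pFrobenius_autE; ring.
Qed.

Variables (D : K -> K) (x : K).
Hypotheses (hD : @twisted_der K K idfun D) (Dx : D x != 0).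
Hypothesis span : forall z, exists q, z = (q^Fr).[x].

(** In the basis 1, x, .., x^(p-1), the vanishing of D z kills the derivative of the coordinate
    polynomial, which is therefore constant. *)
Lemma der_eq0_pexp z : D z = 0 -> exists y, y ^+ p = z.
Proof.
move=> Dz; have [q0 e] := span z; have [q sq eq] := frob_horner_small x q0.
have: D (q^Fr).[x] = 0 by rewrite eq -e.
rewrite (twisted_der_frob_horner _ _ hD) => /eqP.
rewrite mulf_eq0 (negbTE Dx) orbF => /eqP.
move/(frob_horner_eq0 hD Dx) => q'0.
have {}q'0 : q^`() = 0.
  apply: q'0; have [->|q0'] := eqVneq q 0; first by rewrite deriv0 size_poly0.
  exact: leq_trans (ltnW (lt_size_deriv q0')) sq.
exists q`_0; rewrite e -eq (deriv_eq0_small sq q'0) map_polyC hornerC.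
by rewrite coefC.
Qed.

(* 1, g, .., g^(p-1) is again a basis of K over K^p, and in this basis D h has no
   component along g^(p-1). *)
Lemma pred_exp_not_exact g h : D g = 1 -> D h <> g ^+ p.-1.
Proof.
move=> Dg Dh; have p0 : (0 < p)%N by apply: prime_gt0; apply: pcharf_prime charK.
have Dg0 : D g != 0 by rewrite Dg oner_neq0.
have span' z : exists v : 'rV_p, z = ((rVpoly v)^Fr).[x].
  have [q0 ->] := span z; have [q sq <-] := frob_horner_small x q0.
  by exists (poly_rV q); rewrite poly_rV_K.
have /choice [c hc] : forall j : 'I_p, exists v : 'rV_p,
  g ^+ j = ((rVpoly v)^Fr).[x] by move=> j; apply: span'.
pose M := \matrix_j c j.
(* Row j of [M] holds the coordinates of g^j in the powers of x, before Frobenius is applied to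
   them; hence [v *m M] converts coordinates from powers of g to powers of x. *)
have comb (v : 'rV_p) : ((rVpoly (v *m M))^Fr).[x] = ((rVpoly v)^Fr).[g].
  rewrite mulmx_sum_row linear_sum /= rmorph_sum /= horner_sum.
  rewrite [in RHS]horner_coef.
  have s : (size (map_poly Fr (rVpoly v)) <= p)%N.
    by rewrite size_map_poly size_poly.
  rewrite (big_ord_widen _ (fun k => ((rVpoly v)^Fr)`_k * g ^+ k) s) [RHS]big_mkcond /=.
  apply: eq_bigr => j _; rewrite coef_map /= coef_rVpoly_ord rowK.
  rewrite linearZ /= map_polyZ hornerZ /= -hc.
  case: ltnP => // /leq_sizeP /(_ _ (leqnn _)).
  by rewrite coef_map /= coef_rVpoly_ord => ->; rewrite mul0r.
(* The powers of g are independent because D g = 1, so the square matrix [M] has trivial kernel. *)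
have unitM : M \in unitmx.
  rewrite -row_free_unit -kermx_eq0; apply/rowV0P => v /sub_kermxP vM.
  have: ((rVpoly v)^Fr).[g] = 0 by rewrite -comb vM linear0 rmorph0 horner0.
  move/(frob_horner_eq0 hD Dg0); rewrite size_poly => /(_ isT) e.
  by rewrite -(rVpolyK v) e linear0.
have [w hw] := span' h.
have {}hw : h = ((rVpoly (w *m invmx M))^Fr).[g] by rewrite -comb mulmxKV.
set q := rVpoly _ in hw.
have sq : (size q <= p)%N by apply: size_poly.
move: Dh; rewrite hw (twisted_der_frob_horner _ _ hD) Dg mulr1 /= => e.
have: q^`() - 'X^(p.-1) = 0.
  apply: (frob_horner_eq0 hD Dg0).
    rewrite (leq_trans (size_polyD _ _)) // size_polyN size_polyXn prednK //.
    rewrite geq_max leqnn andbT.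
    have [->|q0] := eqVneq q 0; first by rewrite deriv0 size_poly0.
    exact: leq_trans (ltnW (lt_size_deriv q0)) sq.
  by rewrite rmorphB /= map_polyXn !hornerE e subrr.
move/(congr1 (fun r : {poly K} => r`_p.-1)).
(* The coefficient of degree p - 1 in a derivative is p times something, hence 0, while that of
   'X^(p-1) is 1. *)
rewrite coefB coef_deriv coefXn eqxx coef0 prednK // -[q`_p *+ p]mulr_natr.
by rewrite (pcharf0 charK) mulr0 sub0r => /eqP; rewrite oppr_eq0 oner_eq0.
Qed.

End PBasis.

(** * Torsion-freeness of the coordinate ring of E_c^0 *)

Section MpolyMorphisms.

Lemma mpoly_morph_ext (R S : comNzRingType) n
    (f g : {rmorphism {mpoly R[n]} -> S}) :
  (forall c, f c%:MP = g c%:MP) -> (forall k, f 'X_k = g 'X_k) -> f =1 g.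
Proof.
move=> eC eX; elim/mpolyind => [|c m q _ _ IH]; first by rewrite !rmorph0.
rewrite !rmorphD -mul_mpolyC !rmorphM /= eC IH mpolyXE_id !rmorph_prod.
by congr (_ * _ + _); apply: eq_bigr => k _; rewrite !rmorphXn /= eX.
Qed.

Lemma mmapU (R S : comNzRingType) n (f : {rmorphism R -> S}) (h : 'I_n -> S) k :
  mmap f h 'X_k = h k.
Proof. by rewrite mmapX mmap1U. Qed.

End MpolyMorphisms.

Section Saturation.

Definition ideal_pred (T : comNzRingType) (I : T -> Prop) :=
  [/\ I 0, forall x y, I x -> I y -> I (x - y) & forall a x, I x -> I (a * x)].

Lemma ideal_predD (T : comNzRingType) (I : T -> Prop) x y :
  ideal_pred I -> I x -> I y -> I (x + y).
Proof.
by move=> [I0 IB IM] Ix Iy; rewrite -[y]opprK; apply: (IB) => //; rewrite -sub0r; apply: (IB).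
Qed.

Lemma ideal_pred_sum (T : comNzRingType) (I : T -> Prop) (J : Type) (r : seq J)
    (P : pred J) (F : J -> T) :
  ideal_pred I -> (forall i, P i -> I (F i)) -> I (\sum_(i <- r | P i) F i).
Proof.
move=> hI h; apply: (big_ind I); first by case: hI.
  by move=> x y; apply: ideal_predD.
by move=> i /h.
Qed.

Lemma in_ideal_pred (T : comNzRingType) (G : seq T) : ideal_pred (in_ideal G).
Proof.
by split; [apply: in_ideal0|move=> x y; apply: in_idealB|move=> a x; apply: in_idealM].
Qed.

(** Reduces a property of all elements of an ideal to its generators. It is applied to preimages of
    ideals under ring maps and to kernels on which a derivation must vanish. *)
Lemma in_ideal_sub (T : comNzRingType) (G : seq T) (I : T -> Prop) x :
  ideal_pred I -> (forall g, g \in G -> I g) -> in_ideal G x -> I x.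
Proof.
move=> hI h [c ->]; apply: ideal_pred_sum => // i _.
by case: hI => _ _; apply; apply/h/mem_nth.
Qed.

Lemma in_ideal_mem (T : comNzRingType) (G : seq T) x : x \in G -> in_ideal G x.
Proof.
move=> xG; have lt : (index x G < size G)%N by rewrite index_mem.
exists (fun i => (i == Ordinal lt)%:R); rewrite (bigD1 (Ordinal lt)) //=.
rewrite eqxx mul1r nth_index // big1 ?addr0 // => i /negbTE ->.
by rewrite mul0r.
Qed.

Variable p : nat.

(** Regularity of [p] on T/I, phrased without forming the quotient. *)
Definition saturated (T : comNzRingType) (I : T -> Prop) :=
  forall x, I (p%:R * x) -> I x.

Section Poly.
Variables (T : comNzRingType) (I : T -> Prop) (hI : ideal_pred I).

(** The ideal I T[X] + (g), whose quotient is (T/I)[X]/(g). *)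
Definition poly_ideal (g f : {poly T}) := exists u, forall i, I (f - u * g)`_i.

Lemma poly_ideal_pred g : ideal_pred (poly_ideal g).
Proof.
have [I0 IB IM] := hI; split.
- by exists 0 => i; rewrite mul0r subrr coef0.
- move=> x y [u hu] [v hv]; exists (u - v) => i.
  have -> : x - y - (u - v) * g = (x - u * g) - (y - v * g) by ring.
  by rewrite coefB; apply: (IB).
- move=> a x [u hu]; exists (a * u) => i.
  rewrite -mulrA -mulrBr coefM; apply: ideal_pred_sum => // j _; exact: IM.
Qed.

Lemma poly_ideal_gen g : poly_ideal g g.
Proof. by exists 1 => i; rewrite mul1r subrr coef0; case: hI. Qed.

Lemma poly_idealC g c : I c -> poly_ideal g c%:P.
Proof.
move=> Ic; exists 0 => i; rewrite mul0r subr0 coefC.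
by case: eqP => // _; case: hI.
Qed.

Lemma poly_ideal_morph (P : comNzRingType) (h : {rmorphism T -> P})
    (J : P -> Prop) (y : P) g f :
  ideal_pred J -> (forall t, I t -> J (h t)) -> J (map_poly h g).[y] ->
  poly_ideal g f -> J (map_poly h f).[y].
Proof.
move=> hJ IJ Jg [u hu]; have [_ _ JM] := hJ.
rewrite -[f](subrK (u * g)) rmorphD rmorphM /= hornerD hornerM.
apply: ideal_predD => //; last exact: JM.
rewrite horner_coef; apply: ideal_pred_sum => // i _.
by rewrite mulrC coef_map; apply/JM/IJ.
Qed.

(** For monic g, (T/I)[X]/(g) is free over T/I. Concretely, after division by g one has p r = u g
    modulo I with r of smaller degree than g, which forces u = 0 and then p r = 0 modulo I. *)
Lemma monic_saturated g : g \is monic -> saturated I -> saturated (poly_ideal g).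
Proof.
move=> mg sI f [u0 hu0]; have [I0 IB IM] := hI.
have ef := Pdiv.RingMonic.rdivp_eq mg f.
have lt : (size (Pdiv.Ring.rmodp f g) < size g)%N.
  by rewrite Pdiv.Ring.ltn_rmodpN0 // monic_neq0.
set f' := Pdiv.Ring.rdivp f g in ef; set r := Pdiv.Ring.rmodp f g in ef lt.
pose u := u0 - p%:R * f'.
have hu i : I (p%:R * r - u * g)`_i.
  suff -> : p%:R * r - u * g = p%:R * f - u0 * g by apply: hu0.
  by rewrite {1}ef /u; ring.
have [d hd] : exists d, size g = d.+1.
  by exists (size g).-1; rewrite prednK // (leq_ltn_trans _ lt).
have Iu n : forall i, (size u <= i + n)%N -> I u`_i.
  elim: n => [|n IH] i; first by rewrite addn0 => h; rewrite nth_default.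
  move=> h; have := hu (i + d)%N; rewrite coefB [(p%:R * r)]mulrC -[p%:R](rmorph_nat polyC).
  rewrite coefMC (_ : r`_(i + d) = 0); last first.
    by rewrite nth_default // (leq_trans _ (leq_addl _ _)) // -ltnS -hd.
  rewrite mul0r sub0r coefM => H.
  have lt_i : (i < (i + d).+1)%N by rewrite ltnS leq_addr.
  have {H} := IB _ _ I0 H; rewrite sub0r opprK (bigD1 (Ordinal lt_i)) //=.
  rewrite addKn (_ : g`_d = 1); last by move/monicP: mg; rewrite lead_coefE hd.
  rewrite mulr1; set s := \sum_(_ < _ | _) _ => H.
  rewrite -[u`_i](addrK s); apply: (IB) => //; apply: ideal_pred_sum => // j.
  rewrite -val_eqE /= => ne; case: (ltngtP j i) => [lt_ji|lt_ij|/eqP]; last by rewrite (negbTE ne).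
    rewrite [g`__]nth_default ?mulr0 //.
    by rewrite hd; lia.
  by rewrite mulrC; apply: (IM); apply: IH; rewrite (leq_trans h) // addnS -addSn leq_add2r.
exists f' => i; rewrite {1}ef addrAC subrr add0r; apply: sI.
rewrite -(subrK (u * g)`_i (p%:R * _)); apply: ideal_predD => //; last first.
  rewrite coefM; apply: ideal_pred_sum => // j _.
  by rewrite mulrC; apply: (IM); apply: (Iu (size u)); rewrite leq_addl.
by have := hu i; rewrite coefB -[X in X * r](rmorph_nat polyC) coefCM.
Qed.

(** The quotient is the localization of T/I at q, and localization is flat. The proof divides the
    multiplier u by p, and then cancels p coefficientwise. *)
Lemma loc_saturated q : saturated I -> saturated (poly_ideal ('X * q%:P - 1)).
Proof.
move=> sI f [u hu]; have [I0 IB IM] := hI.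
have coefg (w : {poly T}) i : (w * ('X * q%:P - 1))`_i =
    (if i is j.+1 then w`_j * q else 0) - w`_i.
  rewrite mulrBr mulr1 coefB mulrA coefMC coefMX; case: i => [|i] //=.
  by rewrite mul0r.
have coefp (w : {poly T}) i : (p%:R * w)`_i = p%:R * w`_i.
  by rewrite -[X in X * w](rmorph_nat polyC) coefCM.
(* Comparing coefficients gives u_0 = - p f_0 and u_(i+1) = u_i q - p f_(i+1) modulo I, so
   divisibility by p propagates upwards. *)
have /choice [v hv] i : exists v, I (u`_i - p%:R * v).
  elim: i => [|i [v hv]].
    exists (- f`_0); have := hu 0%N; rewrite coefB coefp coefg sub0r.
    by rewrite opprK mulrN opprK addrC.
  exists (v * q - f`_i.+1); have := hu i.+1; rewrite coefB coefp coefg => H.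
  have {hv} := IM q _ hv => /(ideal_predD hI H); congr I; ring.
pose w := \poly_(i < size u) v i.
have hw i : I (u - p%:R * w)`_i.
  rewrite coefB coefp coef_poly; case: ltnP => // ge.
  by rewrite nth_default // mulr0 subr0.
exists w => i; apply: sI; rewrite -coefp.
have -> : p%:R * (f - w * ('X * q%:P - 1)) =
  (p%:R * f - u * ('X * q%:P - 1)) + (u - p%:R * w) * ('X * q%:P - 1) by ring.
rewrite coefD; apply: ideal_predD => //; rewrite coefg; apply: (IB) => //.
by case: i => // i; rewrite mulrC; apply: (IM).
Qed.

End Poly.

End Saturation.

(** Here x_0 is the inner variable and x_1 the outer one. With (e0, e1) equal to the first two a_i,
    or to (1, 1), the left side is an equation of E_c, expressed on the right by the monic
    relations. *)
Lemma quadric_elim (R : comNzRingType) (e0 e1 m0 m1 : R) :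
  e0%:P%:P * ('X ^+ 2)%:P + e1%:P%:P * 'X ^+ 2 + (- (e0 * m0 + e1 * m1))%:P%:P
  = (e0%:P * ('X ^+ 2 - m0%:P))%:P + e1%:P%:P * ('X ^+ 2 - m1%:P%:P).
Proof. by rewrite !(polyCN, polyCD, polyCB, polyCM); ring. Qed.

(* Over A[x_2] the equations of E_c become x_0^2 = mu0 and x_1^2 = mu1; adjoining
   first x_0, then x_1 by monic equations and finally y = 1/Q keeps p regular. *)
Section CurveTorsionFree.
Variables (A : idomainType) (p : nat) (a : 'I_3 -> A) (c : 'I_2 -> A).
Hypothesis p0 : p%:R != 0 :> A.
Hypothesis ua : (a 0 - a 1) \is a GRing.unit.

Let d := (a 0 - a 1)^-1.
(** Cramer's rule: the equations of E_c are linear in x_0^2 and x_1^2, with determinant a_0 -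
    a_1. *)
Let mu0 : {poly A} :=
  d%:P * ((c 0 - a 1 * c 1)%:P + (a 1 - a 2)%:P * 'X^2).
Let mu1 : {poly A} :=
  - d%:P * ((c 0 - a 0 * c 1)%:P + (a 0 - a 2)%:P * 'X^2).

(** The tower is A[x_2][x_0][x_1], with y = 1/Q outermost: x_2 stays free, so it comes first. *)
Let var3 (i : 'I_3) : {poly {poly {poly A}}} :=
  if i == 0 then 'X%:P else if i == 1 then 'X else 'X%:P%:P.

Let const3 : {rmorphism A -> {poly {poly {poly A}}}} := polyC \o polyC \o polyC.
Let theta3 : {rmorphism {mpoly A[3]} -> _} := mmap const3 var3.

Let var4 (i : 'I_4) : {poly {poly {poly {poly A}}}} :=
  if unlift ord_max i is Some j then (var3 j)%:P else 'X.
Let var4_lift j : var4 (lift ord_max j) = (var3 j)%:P.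
Proof. by rewrite /var4 liftK. Qed.
Let var4_max : var4 ord_max = 'X.
Proof. by rewrite /var4 unlift_none. Qed.
Let const4 : {rmorphism A -> {poly {poly {poly {poly A}}}}} := polyC \o const3.
Let theta4 : {rmorphism {mpoly A[4]} -> _} := mmap const4 var4.

Let theta3C x : theta3 x%:MP = x%:P%:P%:P. Proof. exact: mmapC. Qed.
Let theta3X k : theta3 'X_k = var3 k. Proof. exact: mmapU. Qed.
Let theta4C x : theta4 x%:MP = x%:P%:P%:P%:P. Proof. exact: mmapC. Qed.
Let theta4X k : theta4 'X_k = var4 k. Proof. exact: mmapU. Qed.

Let theta4_mwiden f : theta4 (mwiden f) = (theta3 f)%:P.
Proof.
apply: (mpoly_morph_ext (f := theta4 \o @mwiden 3 A) (g := polyC \o theta3)).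
  by move=> x; change (theta4 (mwiden x%:MP) = (theta3 x%:MP)%:P); rewrite mwidenC theta4C theta3C.
move=> k; change (theta4 (mwiden 'X_k) = (theta3 'X_k)%:P).
rewrite mwidenX mnmwiden1 theta4X theta3X.
have -> : widen_ord (leqnSn 3) k = lift ord_max k by apply/val_inj; rewrite /= /bump leqNgt ltn_ord.
exact: var4_lift.
Qed.

(** Evaluating the tower one variable at a time, at x_2, x_0, x_1 and y, undoes [theta4]. *)
Let psi1 : {rmorphism {poly A} -> {mpoly A[4]}} :=
  horner_eval 'X_(inord 2) \o map_poly (@mpolyC 4 A).
Let psi2 : {rmorphism _ -> {mpoly A[4]}} := horner_eval 'X_(inord 0) \o map_poly psi1.
Let psi3 : {rmorphism _ -> {mpoly A[4]}} := horner_eval 'X_(inord 1) \o map_poly psi2.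
Let psi4 : {rmorphism _ -> {mpoly A[4]}} := horner_eval 'X_(inord 3) \o map_poly psi3.

Let psi1C x : psi1 x%:P = x%:MP.
Proof. by rewrite /= map_polyC /horner_eval hornerC. Qed.
Let psi2C x : psi2 x%:P = psi1 x.
Proof. by rewrite [LHS]/= map_polyC /horner_eval hornerC. Qed.
Let psi3C x : psi3 x%:P = psi2 x.
Proof. by rewrite [LHS]/= map_polyC /horner_eval hornerC. Qed.
Let psi4C x : psi4 x%:P = psi3 x.
Proof. by rewrite [LHS]/= map_polyC /horner_eval hornerC. Qed.
Let psi1X : psi1 'X = 'X_(inord 2).
Proof. by rewrite /= map_polyX /horner_eval hornerX. Qed.
Let psi2X : psi2 'X = 'X_(inord 0).
Proof. by rewrite [LHS]/= map_polyX /horner_eval hornerX. Qed.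
Let psi3X : psi3 'X = 'X_(inord 1).
Proof. by rewrite [LHS]/= map_polyX /horner_eval hornerX. Qed.
Let psi4X : psi4 'X = 'X_(inord 3).
Proof. by rewrite [LHS]/= map_polyX /horner_eval hornerX. Qed.

Let theta4K f : psi4 (theta4 f) = f.
Proof.
apply: (mpoly_morph_ext (f := psi4 \o theta4) (g := idfun)).
  move=> x; change (psi4 (theta4 x%:MP) = x%:MP).
  by rewrite theta4C psi4C psi3C psi2C psi1C.
move=> k; change (psi4 (theta4 'X_k) = 'X_k); rewrite theta4X.
case: (unliftP ord_max k) => [j|] ->; last first.
  by rewrite var4_max psi4X; congr 'X_(_); apply/val_inj; rewrite /= inordK.
rewrite var4_lift psi4C /var3; case: j => -[|[|[|//]]] lt.
- by rewrite psi3C psi2X; congr 'X_(_); apply/val_inj; rewrite /= inordK.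
- by rewrite psi3X; congr 'X_(_); apply/val_inj; rewrite /= inordK.
- by rewrite psi3C psi2C psi1X; congr 'X_(_); apply/val_inj; rewrite /= inordK.
Qed.

Let g0 : {poly {poly A}} := 'X^2 - mu0%:P.
Let g1 : {poly {poly {poly A}}} := 'X^2 - mu1%:P%:P.
Let I1 := poly_ideal (fun x : {poly A} => x = 0) g0.
Let I2 := poly_ideal I1 g1.
Let I3 := poly_ideal I2 ('X * (theta3 (Qpol p a))%:P - 1).

Let I0_pred : ideal_pred (fun x : {poly A} => x = 0).
Proof. by split=> [|x y -> ->|x y ->]; rewrite ?subr0 ?mulr0. Qed.
Let I1_pred : ideal_pred I1. Proof. exact: poly_ideal_pred. Qed.
Let I2_pred : ideal_pred I2. Proof. exact: poly_ideal_pred. Qed.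
Let I3_pred : ideal_pred I3. Proof. exact: poly_ideal_pred. Qed.

Let I3_saturated : saturated p I3.
Proof.
apply: loc_saturated => //; apply: monic_saturated => //; first exact: monicXnsubC.
apply: monic_saturated => //; first exact: monicXnsubC.
move=> x /eqP; rewrite mulf_eq0 -[p%:R](rmorph_nat polyC) polyC_eq0 (negbTE p0).
by move/eqP.
Qed.

Let dK : d * (a 0 - a 1) = 1. Proof. exact: mulVr. Qed.

Let quad (b : 'I_3 -> A) e :
  theta3 (\sum_i b i *: 'X_i ^+ 2 - e%:MP) =
  (b 0)%:P%:P%:P * ('X ^+ 2)%:P + (b 1)%:P%:P%:P * 'X ^+ 2
  + ((b 2)%:P * 'X ^+ 2 - e%:P)%:P%:P.
Proof.
rewrite rmorphB theta3C rmorph_sum /=.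
rewrite (eq_bigr (fun i => (b i)%:P%:P%:P * var3 i ^+ 2)) => [|i _]; last first.
  by rewrite -mul_mpolyC rmorphM theta3C rmorphXn /= theta3X.
rewrite !big_ord_recl big_ord0.
rewrite (_ : lift ord0 ord0 = 1); last exact/val_inj.
rewrite (_ : lift ord0 (lift ord0 ord0) = 2); last exact/val_inj.
rewrite (_ : ord0 = 0); last exact/val_inj.
by rewrite /var3 /= addr0 polyCB polyCB [((b 2)%:P * _)%:P]polyCM
  [((b 2)%:P%:P * _)%:P]polyCM !polyC_exp !addrA.
Qed.

Let I2_H1 : I2 (theta3 (H1 a - (c 0)%:MP)).
Proof.
rewrite quad.
have -> : (a 2)%:P * 'X ^+ 2 - (c 0)%:P = - ((a 0)%:P * mu0 + (a 1)%:P * mu1).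
  rewrite /mu0 /mu1 -[LHS]mul1r -[1](rmorph1 polyC) -dK.
  by rewrite !(rmorphB, rmorphM) /=; ring.

have [_ _ IM1] := I1_pred; have [_ _ IM2] := I2_pred.
rewrite quadric_elim -/g0 -/g1.
apply: ideal_predD => //; first by apply/poly_idealC/IM1/poly_ideal_gen.
exact/IM2/poly_ideal_gen.
Qed.

Let I2_H2 : I2 (theta3 (H2 A - (c 1)%:MP)).
Proof.
rewrite (_ : H2 A = \sum_i 1 *: 'X_i ^+ 2); last first.
  by apply: eq_bigr => i _; rewrite scale1r.
rewrite quad.
have -> : 1%:P * 'X ^+ 2 - (c 1)%:P = - (1%:P * mu0 + 1%:P * mu1).
  rewrite !polyC1 !mul1r /mu0 /mu1 -[LHS]mul1r -[1](rmorph1 polyC) -dK.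
  by rewrite !(rmorphB, rmorphM) /=; ring.
rewrite quadric_elim -/g0 -/g1 !polyC1 !mul1r.
apply: ideal_predD => //; last exact: poly_ideal_gen.
exact/poly_idealC/poly_ideal_gen.
Qed.

Let J := in_ideal (eqs (E0 p a c)).
Let J_pred : ideal_pred J. Proof. exact: in_ideal_pred. Qed.

Let quad4 (b : 'I_3 -> A) e :
  mwiden (\sum_i b i *: 'X_i ^+ 2 - e%:MP) =
  (b 0)%:MP * 'X_(inord 0) ^+ 2 + (b 1)%:MP * 'X_(inord 1) ^+ 2
  + (b 2)%:MP * 'X_(inord 2) ^+ 2 - e%:MP :> {mpoly A[4]}.
Proof.
rewrite rmorphB /= mwidenC rmorph_sum /=.
have wE k (i : 'I_3) : i = k :> nat ->
    mwiden (b i *: 'X_i ^+ 2) = (b i)%:MP * 'X_(inord k) ^+ 2 :> {mpoly A[4]}.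
  move=> ik; rewrite mwidenZ rmorphXn /= mwidenX mnmwiden1 mul_mpolyC.
  congr (_ *: 'X_(_) ^+ 2); apply/val_inj; rewrite /= inordK ?ik //.
  by rewrite -ik (leq_trans (ltn_ord i)).
rewrite !big_ord_recl big_ord0 (wE 0) // (wE 1) // (wE 2) //.
rewrite (_ : lift ord0 ord0 = 1); last exact/val_inj.
rewrite (_ : lift ord0 (lift ord0 ord0) = 2); last exact/val_inj.
by rewrite addr0 !addrA.
Qed.

Let G0 : {mpoly A[4]} := mwiden (H1 a - (c 0)%:MP).
Let G1 : {mpoly A[4]} := mwiden (H2 A - (c 1)%:MP).
Let G0E : G0 = (a 0)%:MP * 'X_(inord 0) ^+ 2 + (a 1)%:MP * 'X_(inord 1) ^+ 2
  + (a 2)%:MP * 'X_(inord 2) ^+ 2 - (c 0)%:MP.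
Proof. exact: quad4. Qed.
Let G1E : G1 = 'X_(inord 0) ^+ 2 + 'X_(inord 1) ^+ 2 + 'X_(inord 2) ^+ 2 - (c 1)%:MP.
Proof.
rewrite /G1 (_ : H2 A = \sum_i 1 *: 'X_i ^+ 2); last first.
  by apply: eq_bigr => i _; rewrite scale1r.
by rewrite (quad4 (fun _ => 1)) !mul1r.
Qed.

Let JG0 : J G0. Proof. by apply: in_ideal_mem; rewrite /= inE eqxx. Qed.
Let JG1 : J G1. Proof. by apply: in_ideal_mem; rewrite /= !inE eqxx orbT. Qed.

(** Elimination in the other direction: Cramer's rule writes each monic relation as a combination of
    the two quadrics. *)
Let J_g0 : J (psi2 g0).
Proof.
have -> : psi2 g0 = d%:MP * (G0 - (a 1)%:MP * G1).
  rewrite /g0 rmorphB rmorphXn psi2X psi2C /mu0.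
  rewrite rmorphM rmorphD rmorphM rmorphXn !psi1C psi1X.
  rewrite -['X_(inord 0) ^+ 2 in LHS]mul1r -[1](mpolyC1 4 A) -dK G0E G1E.
  by rewrite !(mpolyCM, mpolyCB); ring.
have [_ JB JM] := J_pred; apply: (JM); apply: (JB) => //; exact: JM.
Qed.

Let J_g1 : J (psi3 g1).
Proof.
have -> : psi3 g1 = d%:MP * ((a 0)%:MP * G1 - G0).
  rewrite /g1 rmorphB rmorphXn psi3X psi3C psi2C /mu1.
  rewrite rmorphM rmorphN rmorphD rmorphM rmorphXn !psi1C psi1X.
  rewrite -['X_(inord 1) ^+ 2 in LHS]mul1r -[1](mpolyC1 4 A) -dK G0E G1E.
  by rewrite !(mpolyCM, mpolyCB); ring.
have [_ JB JM] := J_pred; apply: (JM); apply: (JB) => //; exact: JM.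
Qed.

Let psi3_theta3 f : psi3 (theta3 f) = mwiden f.
Proof. by rewrite -psi4C -theta4_mwiden theta4K. Qed.

Let J_loc : J (psi4 ('X * (theta3 (Qpol p a))%:P - 1)).
Proof.
rewrite (rmorphB psi4) (rmorphM psi4) (rmorph1 psi4) psi4X psi4C psi3_theta3.
rewrite (_ : inord 3 = ord_max); last by apply/val_inj; rewrite /= inordK.
by apply: in_ideal_mem; rewrite /= !inE eqxx !orbT.
Qed.

Let J_I3 f : I3 f -> J (psi4 f).
Proof.
apply: (poly_ideal_morph J_pred) => [t|]; last exact: J_loc.
apply: (poly_ideal_morph J_pred) => [{}t|]; last exact: J_g1.
apply: (poly_ideal_morph J_pred) => [{}t ->|]; last exact: J_g0.
by rewrite rmorph0; case: J_pred.
Qed.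

(** [theta4] sends the equations of E_c^0 into [I3] and [psi4] sends [I3] back into their ideal, so
    the regularity of p on the tower transfers. *)
Lemma E0_saturated : saturated p (in_ideal (eqs (E0 p a c))).
Proof.
move=> f Jf; rewrite -[f]theta4K; apply/J_I3/I3_saturated.
have <- : theta4 (p%:R * f) = p%:R * theta4 f by rewrite rmorphM rmorph_nat.
have I3_pull : ideal_pred (fun g => I3 (theta4 g)).
  have [z B M] := I3_pred; split; first by rewrite rmorph0.
    by move=> x y Ix Iy; rewrite (rmorphB theta4); exact: (B (theta4 x) (theta4 y)).
  by move=> x y Iy; rewrite (rmorphM theta4); exact: (M (theta4 x) (theta4 y)).
apply: (in_ideal_sub I3_pull _ Jf) => g.
rewrite /= !inE => /or3P[] /eqP ->.
- by rewrite theta4_mwiden; apply: (poly_idealC I2_pred _ I2_H1).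
- by rewrite theta4_mwiden; apply: (poly_idealC I2_pred _ I2_H2).
rewrite (rmorphB theta4) (rmorphM theta4) (rmorph1 theta4) theta4X theta4_mwiden var4_max.
exact: poly_ideal_gen.
Qed.

End CurveTorsionFree.

(** Induction along ring generators also serves existence statements and maps that are not packaged
    as morphisms. *)
Lemma mpoly_closed_ind (R : nzRingType) n (P : {mpoly R[n]} -> Prop) :
  (forall c, P c%:MP) -> (forall k, P 'X_k) ->
  (forall f g, P f -> P g -> P (f + g)) -> (forall f g, P f -> P g -> P (f * g)) ->
  forall f, P f.
Proof.
move=> PC PX PD PM; elim/mpolyind => [|c m f _ _ Pf]; first exact: PC 0.
apply: PD Pf; rewrite -mul_mpolyC; apply: (PM) => //; rewrite mpolyXE_id.
apply: (big_ind P); [exact: (PC 1)|exact: (PM)|move=> k _].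
elim: (m k) => [|e IH]; first exact: (PC 1).
by rewrite exprS; apply: (PM).
Qed.

(** * Adic limits *)

Section Limits.
Variables (V : zmodType) (F : filt V).
Implicit Types (x y : clim F) (b : nat -> V).

Lemma capproxD x y b b' : capprox x b -> capprox y b' ->
  capprox (x + y) (fun n => b n + b' n).
Proof. exact: climD_approx. Qed.

Lemma capproxN x b : capprox x b -> capprox (- x) (fun n => - b n).
Proof. exact: climN_approx. Qed.

Lemma capprox0 : capprox (0 : clim F) (fun _ => 0).
Proof. exact: clim0_approx. Qed.

Lemma capprox_sub x b n : capprox x b -> F n (rep x n) -> F n (b n).
Proof.
by move=> h /filtB /(_ (h n)); rewrite opprB addrCA subrr addr0.
Qed.

Lemma capproxMn x b m : capprox x b -> capprox (x *+ m) (fun n => b n *+ m).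
Proof.
move=> h; elim: m => [|m IH]; first exact: capprox0.
rewrite mulrS; apply: eq_capprox (fun n => esym (mulrS _ _)) _.
exact: capproxD.
Qed.

End Limits.

Section RingLimits.
Variables (R : comNzRingType) (F : ifilt R).
Implicit Types (x y : rlim F) (b : nat -> R).

Lemma capproxM x y b b' : capprox x b -> capprox y b' ->
  capprox (x * y) (fun n => b n * b' n).
Proof. exact: rlimM_approx. Qed.

Lemma capprox1 : capprox (1 : rlim F) (fun _ => 1).
Proof. exact: rlim1_approx. Qed.

Lemma capproxX x b m : capprox x b -> capprox (x ^+ m) (fun n => b n ^+ m).
Proof.
move=> h; elim: m => [|m IH]; first exact: capprox1.
rewrite exprS; apply: eq_capprox (fun n => esym (exprS _ _)) _.
exact: capproxM.
Qed.

Lemma capprox_nat m : capprox (m%:R : rlim F) (fun _ => m%:R).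
Proof. exact: capproxMn capprox1. Qed.

End RingLimits.

Section AdicLimits.
Variables (R : comNzRingType) (p : nat) (G : seq R).
Local Notation F := (adic_ifilt p G).

Lemma in_ideal_sub_seq (G' : seq R) f :
  (forall g, g \in G -> in_ideal G' g) -> in_ideal G f -> in_ideal G' f.
Proof. by move=> h; apply: in_ideal_sub => //; apply: in_ideal_pred. Qed.

Lemma in_ideal_cons g f : in_ideal G f -> in_ideal (g :: G) f.
Proof. by apply: in_ideal_sub_seq => h hG; apply: in_ideal_mem; rewrite inE hG orbT. Qed.

Lemma in_ideal_consP g f :
  in_ideal (g :: G) f <-> exists a h, in_ideal G h /\ f = a * g + h.
Proof.
split.
  move=> [c ->]; exists (c ord0), (\sum_i c (lift ord0 i) * G`_i).
  split; first by exists (fun i => c (lift ord0 i)).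
  by rewrite big_ord_recl.
move=> [a [h [hh ->]]]; apply: (ideal_predD (in_ideal_pred _)).
  by apply: in_idealM; apply: in_ideal_mem; rewrite inE eqxx.
exact: in_ideal_cons.
Qed.

Lemma adic_limit_eq0 (x : rlim F) :
  (forall n, in_ideal (p%:R ^+ n :: G) (rep x n)) -> x = 0.
Proof.
by move=> h; apply: (capprox_eq (b := fun=> 0)) (capprox0 _) => n; rewrite subr0; exact: h.
Qed.

(** Dividing by p costs one level: the relation at level n + 1, divided by p thanks to saturation,
    shows that x_(n+1), hence x_n, vanishes at level n. *)
Lemma adic_limit_torsion_free (x : rlim F) :
  saturated p (in_ideal G) -> p%:R * x = 0 -> x = 0.
Proof.
move=> sG px0; apply: adic_limit_eq0 => n.
have h : capprox (0 : rlim F) (fun m => p%:R * rep x m).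
  by rewrite -px0; apply: capproxM (capprox_nat _ _) (capprox_rep x).
have: F n.+1 (p%:R * rep x n.+1).
  by apply: (capprox_sub h); have := capprox0 F n.+1; rewrite subr0.
move=> /in_ideal_consP [a [g [gG e]]].
have [b [g' [g'G e']]] : exists b g', in_ideal G g' /\ rep x n.+1 = b * p%:R ^+ n + g'.
  exists a, (rep x n.+1 - a * p%:R ^+ n); split; last by rewrite addrC subrK.
  by apply: sG; rewrite mulrBr e exprS mulrCA addrAC subrr add0r.
have Fn : F n (rep x n.+1) by apply/in_ideal_consP; exists b, g'.
by have := filtB Fn (rep_coh x n); rewrite opprB addrCA subrr addr0.
Qed.

(* Writing x_(n+1) - x_n = p^n z_n mod G, the limit of the sums z_0 + p z_1 + .. is x / p. *)
Lemma pmul_adic_limit (x : rlim F) :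
  in_ideal (p%:R ^+ 1 :: G) (rep x 1) -> pmul p 1 x.
Proof.
move=> /in_ideal_consP [z0 [g0 [g0G e0]]].
have /choice [z hz] : forall n, exists z,
    in_ideal G (rep x n.+2 - rep x n.+1 - z * p%:R ^+ n.+1).
  move=> n; have /in_ideal_consP [z [g [gG e]]] := rep_coh x n.+1.
  by exists z; rewrite e addrAC subrr add0r.
(* [z0] comes from x_1 itself and [z i] from the difference x_(i+2) - x_(i+1), so p times [y n] is
   x_(n+1) modulo G. *)
pose y n := z0 + \sum_(i < n) z i * p%:R ^+ i.
have yE n : in_ideal G (rep x n.+1 - p%:R * y n).
  elim: n => [|n IH].
    by have := g0G; congr in_ideal; rewrite /y big_ord0 e0; ring.
  have := ideal_predD (in_ideal_pred G) IH (hz n); congr in_ideal.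
  rewrite /y big_ord_recr /= exprS; move: (\sum_(i < n) _) (p%:R ^+ n) => s q; ring.
have cy : coherent F y.
  move=> n; rewrite /y big_ord_recr /=; move: (\sum_(i < n) _) => t.
  have -> : z0 + (t + z n * p%:R ^+ n) - (z0 + t) = z n * p%:R ^+ n by ring.
  by apply: in_idealM; apply: in_ideal_mem; rewrite inE eqxx.
exists (cls F y); rewrite expr1; apply: capprox_eq (capprox_rep x) _.
have h := capproxM (capprox_nat F p) (cls_approx cy).
move=> n; rewrite -(subrKA (p%:R * y n)); apply: filtD; first exact: h.
rewrite -opprB; apply: filtN.
rewrite -(subrKA (rep x n.+1)) -opprB.
apply: filtD; first by apply: filtN; apply: rep_coh.
exact: in_ideal_cons.
Qed.

End AdicLimits.

(** * Polynomials, jets and forms *)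

Section Substitution.
Variables (A : comNzRingType) (n m : nat).
Implicit Types (s : 'I_n -> {mpoly A[m]}) (f g : {mpoly A[n]}).

Lemma substC s x : subst s x%:MP = x%:MP. Proof. exact: mmapC. Qed.
Lemma substX s k : subst s 'X_k = s k. Proof. exact: mmapU. Qed.
Lemma substD s f g : subst s (f + g) = subst s f + subst s g.
Proof. exact: rmorphD. Qed.
Lemma substM s f g : subst s (f * g) = subst s f * subst s g.
Proof. exact: rmorphM. Qed.
Lemma substXn s f e : subst s (f ^+ e) = subst s f ^+ e.
Proof. exact: rmorphXn. Qed.
Lemma substB s f g : subst s (f - g) = subst s f - subst s g.
Proof. exact: rmorphB. Qed.

Lemma substN s f : subst s (- f) = - subst s f.
Proof. exact: rmorphN. Qed.
Lemma subst0 s : subst s 0 = 0. Proof. exact: rmorph0. Qed.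
Lemma subst1 s : subst s 1 = 1. Proof. exact: rmorph1. Qed.
Lemma subst_nat s e : subst s e%:R = e%:R. Proof. exact: rmorph_nat. Qed.

Lemma gradC x : grad (x%:MP : {mpoly A[n]}) = 0.
Proof. by apply/rowP => k; rewrite !mxE mderivC. Qed.

Lemma gradD f g : grad (f + g) = grad f + grad g.
Proof. by apply/rowP => k; rewrite !mxE mderivD. Qed.

Lemma gradN f : grad (- f) = - grad f.
Proof. by apply/rowP => k; rewrite !mxE mderivN. Qed.

Lemma gradM f g : grad (f * g) = f *: grad g + g *: grad f.
Proof. by apply/rowP => k; rewrite !mxE mderivM addrC [_ * g]mulrC. Qed.

Lemma gradX f e : grad (f ^+ e) = (f ^+ e.-1 *+ e) *: grad f.
Proof.
elim: e => [|e IH]; first by rewrite expr0 -mpolyC1 gradC mulr0n scale0r.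
rewrite exprS gradM {}IH scalerA -scalerDl; congr (_ *: _).
case: e => [|e]; first by rewrite mulr0n mulr0 add0r.
by rewrite mulrnAr -exprS -mulrSr.
Qed.

Lemma mderivU j k : ('X_j : {mpoly A[n]})^`M(k) = (j == k)%:R.
Proof.
rewrite mderivX mnm1E; case: eqP => [->|_]; last by rewrite scale0r.
rewrite scale1r (_ : (U_(k) - U_(k))%MM = 0%MM) ?mpolyX0 //.
by apply/mnmP => i; rewrite mnmBE mnm0E subnn.
Qed.

End Substitution.

Section Tangent.
Variables (A : comNzRingType) (K : fieldType) (n : nat).
Variables (u : {rmorphism {mpoly A[n]} -> K}) (t : 'I_n -> K).

(** The derivation along [u] that kills constants and takes the values [t] on the variables. *)
Definition tangent (f : {mpoly A[n]}) : K := \sum_k u f^`M(k) * t k.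

Lemma tangent_der : twisted_der u tangent.
Proof.
split=> f g.
  rewrite /tangent -big_split; apply: eq_bigr => k _.
  by rewrite mderivD rmorphD mulrDl.
rewrite /tangent !mulr_sumr -big_split; apply: eq_bigr => k _.
by rewrite mderivM rmorphD !rmorphM /=; ring.
Qed.

Lemma tangentC x : tangent x%:MP = 0.
Proof. by rewrite /tangent big1 // => k _; rewrite mderivC rmorph0 mul0r. Qed.

Lemma tangentX k : tangent 'X_k = t k.
Proof.
rewrite /tangent (bigD1 k) //= mderivU eqxx rmorph1 mul1r big1 ?addr0 // => j jk.
by rewrite mderivU eq_sym (negbTE jk) rmorph0 mul0r.
Qed.

End Tangent.

Lemma subst_subst (A : comNzRingType) n m l (s : 'I_m -> {mpoly A[l]})
    (t : 'I_n -> {mpoly A[m]}) f :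
  subst s (subst t f) = subst (fun k => subst s (t k)) f.
Proof.
elim/mpoly_closed_ind: f => [c|k|f g IHf IHg|f g IHf IHg].
- by rewrite !substC.
- by rewrite !substX.
- by rewrite !substD IHf IHg.
- by rewrite !substM IHf IHg.
Qed.

Lemma subst_id (A : comNzRingType) n (f : {mpoly A[n]}) :
  subst (fun k => 'X_k) f = f.
Proof.
elim/mpoly_closed_ind: f => [c|k|f g IHf IHg|f g IHf IHg].
- by rewrite !substC.
- by rewrite !substX.
- by rewrite !substD IHf IHg.
- by rewrite !substM IHf IHg.
Qed.

Lemma chain_rule (A : comNzRingType) n m (s : 'I_n -> {mpoly A[m]}) f :
  grad (subst s f) = \sum_k subst s f^`M(k) *: grad (s k).
Proof.
elim/mpoly_closed_ind: f => [c|j|f g IHf IHg|f g IHf IHg].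
- by rewrite substC gradC big1 // => k _; rewrite mderivC subst0 scale0r.
- rewrite substX (bigD1 j) //= big1 => [|k /negbTE kj]; rewrite mderivU.
    by rewrite eqxx subst1 scale1r addr0.
  by rewrite eq_sym kj subst0 scale0r.
- rewrite substD gradD IHf IHg -big_split; apply: eq_bigr => k _.
  by rewrite /= mderivD substD scalerDl.
- rewrite substM gradM IHf IHg !scaler_sumr -big_split; apply: eq_bigr => k _.
  by rewrite /= mderivM substD !substM scalerDl !scalerA [LHS]addrC (mulrC (subst s g)).
Qed.

Section Jets.
Variables (p : nat) (A : comNzRingType) (dA : A -> A).
Hypotheses (p_prime : prime p) (hdA : p_derivation p dA).

Lemma frob_morph : exists phi : {rmorphism A -> A}, phi =1 frob p dA.
Proof.
have [hz hm] := hdA.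
pose phi : A -> A := frob p dA.
pose iz := GRing.isZmodMorphism.Build A A phi hz.
pose im := GRing.isMonoidMorphism.Build A A phi hm.
by pose phiM : {rmorphism A -> A} := HB.pack phi iz im; exists phiM.
Qed.

Variable n : nat.
Local Notation P r := {mpoly A[jdim n r]}.

Lemma phi_univ_morph r : exists Phi : {rmorphism P r -> P r.+1},
  [/\ phi_univ p dA (r := r) =1 Phi, forall x, Phi x%:MP = (frob p dA x)%:MP
    & forall k, Phi 'X_k = 'X_(jwid k) ^+ p + p%:R * 'X_(jshift k)].
Proof.
have [phi phiE] := frob_morph.
pose Phi : {rmorphism P r -> P r.+1} := mmap (@mpolyC _ _ \o phi)
  (fun k => 'X_(jwid k) ^+ p + p%:R * 'X_(jshift k)).
exists Phi; split=> [f|x|k]; last exact: mmapU.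
  by congr mmap; apply/funext => y /=; rewrite phiE.
by rewrite -phiE; apply: mmapC.
Qed.

Lemma phi_univC r x : phi_univ p dA (x%:MP : P r) = (frob p dA x)%:MP.
Proof. by have [Phi [-> C _]] := phi_univ_morph r. Qed.

Lemma phi_univX r k :
  phi_univ p dA ('X_k : P r) = 'X_(jwid k) ^+ p + p%:R * 'X_(jshift k).
Proof. by have [Phi [-> _ X]] := phi_univ_morph r. Qed.

Lemma phi_univD r (f g : P r) :
  phi_univ p dA (f + g) = phi_univ p dA f + phi_univ p dA g.
Proof. by have [Phi [E _ _]] := phi_univ_morph r; rewrite !E rmorphD. Qed.

Lemma phi_univB r (f g : P r) :
  phi_univ p dA (f - g) = phi_univ p dA f - phi_univ p dA g.
Proof. by have [Phi [E _ _]] := phi_univ_morph r; rewrite !E rmorphB. Qed.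

Lemma phi_univM r (f g : P r) :
  phi_univ p dA (f * g) = phi_univ p dA f * phi_univ p dA g.
Proof. by have [Phi [E _ _]] := phi_univ_morph r; rewrite !E rmorphM. Qed.

Lemma phi_univ_nat r e : phi_univ p dA (e%:R : P r) = e%:R.
Proof. by have [Phi [E _ _]] := phi_univ_morph r; rewrite !E rmorph_nat. Qed.

Lemma exprD_mod_prime (R : comNzRingType) (x y : R) :
  exists z, (x + y) ^+ p = x ^+ p + y ^+ p + p%:R * z.
Proof.
case: p p_prime => [|[|q]] // q_prime.
(* The middle binomial coefficients of a prime exponent, divided by that prime. *)
pose z := \sum_(i < q.+1) (x ^+ (q.+2 - i.+1) * y ^+ i.+1) *+ ('C(q.+2, i.+1) %/ q.+2).
exists z; rewrite exprDn big_ord_recl big_ord_recr /= bin0 mulr1 subn0.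
rewrite /bump /= add1n binn subnn !mulr1n expr0 mul1r -[RHS]addrA; congr (_ + _).
rewrite addrC; congr (_ + _); rewrite mulr_sumr; apply: eq_bigr => i _.
rewrite add1n mulr_natl -mulrnA divnK // prime_dvd_bin //=.
by rewrite ltnS ltn_ord.
Qed.

(** Being a Frobenius lift holds on constants and variables and is stable under sums and products.
    Thus the choice in [del_univ] never falls back on its default. *)
Lemma phi_univ_frob r (f : P r) :
  exists g, p%:R * g = phi_univ p dA f - jincl f ^+ p.
Proof.
elim/mpoly_closed_ind: f => [x|k|f g [f' hf] [g' hg]|f g [f' hf] [g' hg]].
- exists (dA x)%:MP; rewrite phi_univC /jincl substC /frob rmorphD rmorphXn /=.
  by rewrite rmorphM rmorph_nat addrAC subrr add0r.
- exists 'X_(jshift k); rewrite phi_univX /jincl substX.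
  by rewrite addrAC subrr add0r.
- have [z hz] := exprD_mod_prime (jincl f) (jincl g).
  exists (f' + g' - z); rewrite phi_univD /jincl substD -!/(jincl _) hz.
  by rewrite mulrBr mulrDr hf hg; ring.
- exists (f' * phi_univ p dA g + jincl f ^+ p * g').
  rewrite phi_univM /jincl substM -!/(jincl _) exprMn.
  have -> : p%:R * (f' * phi_univ p dA g + jincl f ^+ p * g') =
    (p%:R * f') * phi_univ p dA g + jincl f ^+ p * (p%:R * g') by ring.
  by rewrite hf hg; ring.
Qed.

Lemma del_univE r (f : P r) :
  p%:R * del_univ p dA f = phi_univ p dA f - jincl f ^+ p.
Proof. by rewrite /del_univ; case: xgetP => [g -> //|H]; have [g /H] := phi_univ_frob f. Qed.

Lemma phi_univE r (f : P r) :
  phi_univ p dA f = jincl f ^+ p + p%:R * del_univ p dA f.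
Proof. by rewrite del_univE addrC subrK. Qed.

End Jets.

(** * Evaluation of polynomials at tuples of elements of a completed ring *)

Section Evaluation.
Variables (A : comNzRingType) (n m : nat) (F : ifilt {mpoly A[m]}).
Variable v : 'I_n -> rlim F.
Implicit Types f g : {mpoly A[n]}.

Lemma subst_approx e (s s' : 'I_n -> {mpoly A[m]}) f :
  (forall k, F e (s k - s' k)) -> F e (subst s f - subst s' f).
Proof.
move=> h; elim/mpoly_closed_ind: f => [x|k|f g hf hg|f g hf hg].
- by rewrite !substC subrr; apply: filt0.
- by rewrite !substX.
- by rewrite !substD opprD addrACA; apply: filtD.
- by rewrite !substM; apply: ifiltM2.
Qed.

(** Pull-back restricted to polynomials: it makes sense for any tuple [v], so the condition that [v]
    respects the relations can be stated with it. *)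
Definition evl f : rlim F := cls F (fun e => subst (fun k => rep (v k) e) f).

Lemma evl_approx f : capprox (evl f) (fun e => subst (fun k => rep (v k) e) f).
Proof.
apply: cls_approx => e.
by apply: subst_approx => k; apply: rep_coh.
Qed.

Lemma evlC x : evl x%:MP = cls F (fun=> x%:MP).
Proof. by congr cls; apply/funext => e; rewrite substC. Qed.

Lemma evlX k : evl 'X_k = v k.
Proof.
apply: capprox_eq (capprox_rep _); apply: eq_capprox (evl_approx _) => e.
by rewrite substX.
Qed.

Lemma evlD f g : evl (f + g) = evl f + evl g.
Proof.
apply: capprox_eq (capproxD (evl_approx f) (evl_approx g)).
by apply: eq_capprox (evl_approx _) => e; rewrite substD.
Qed.

Lemma evlN f : evl (- f) = - evl f.
Proof.
apply: capprox_eq (capproxN (evl_approx f)).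
by apply: eq_capprox (evl_approx _) => e; rewrite substN.
Qed.

Lemma evlB f g : evl (f - g) = evl f - evl g.
Proof. by rewrite evlD evlN. Qed.

Lemma evlM f g : evl (f * g) = evl f * evl g.
Proof.
apply: capprox_eq (capproxM (evl_approx f) (evl_approx g)).
by apply: eq_capprox (evl_approx _) => e; rewrite substM.
Qed.

Lemma evlXn f i : evl (f ^+ i) = evl f ^+ i.
Proof.
apply: capprox_eq (capproxX i (evl_approx f)).
by apply: eq_capprox (evl_approx _) => e; rewrite substXn.
Qed.

Lemma evl_nat i : evl i%:R = i%:R.
Proof.
apply: capprox_eq (capprox_nat F i).
by apply: eq_capprox (evl_approx _) => e; rewrite subst_nat.
Qed.

End Evaluation.

(** * The submodules of forms that vanish at a given level *)

Section FormFiltration.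
Variables (A : comNzRingType) (m p : nat) (G : seq {mpoly A[m]}).
Implicit Types (w : 'rV[{mpoly A[m]}]_m) (f : {mpoly A[m]}).

Lemma in_forms_coef e w :
  (forall k, in_ideal (p%:R ^+ e :: G) (w 0 k)) -> in_forms p G e w.
Proof.
move=> h; exists (fun=> 0) => k; rewrite big1 ?subr0 // => i _.
by rewrite scale0r.
Qed.

Lemma in_formsD e w w' : in_forms p G e w -> in_forms p G e w' -> in_forms p G e (w + w').
Proof. exact: (@filtD _ (form_filt p G)). Qed.

Lemma in_forms_sum e (I : Type) (r : seq I) (F : I -> 'rV[{mpoly A[m]}]_m) :
  (forall i, in_forms p G e (F i)) -> in_forms p G e (\sum_(i <- r) F i).
Proof.
move=> h; apply: big_ind => //; first exact: in_forms0.
exact: in_formsD.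
Qed.

Lemma in_formsZ e f w : in_forms p G e w -> in_forms p G e (f *: w).
Proof.
move=> [c h]; exists (fun i => f * c i) => k.
rewrite (eq_bigr (fun i => f *: (c i *: grad G`_i))) => [|i _]; last by rewrite scalerA.
by rewrite -scaler_sumr -scalerBr mxE; apply: in_idealM.
Qed.

Lemma in_forms_scale e f w :
  in_ideal (p%:R ^+ e :: G) f -> in_forms p G e (f *: w).
Proof.
by move=> h; apply: in_forms_coef => k; rewrite mxE mulrC; apply: in_idealM.
Qed.

Lemma in_forms_grad_mem e g : g \in G -> in_forms p G e (grad g).
Proof.
move=> gG; have lt : (index g G < size G)%N by rewrite index_mem.
exists (fun i => (i == Ordinal lt)%:R) => k.
rewrite (bigD1 (Ordinal lt)) //= eqxx scale1r nth_index // big1 => [|i /negbTE ->].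
  by rewrite addr0 subrr mxE; apply: in_ideal0.
by rewrite scale0r.
Qed.

Lemma in_forms_ind e (Q : 'rV[{mpoly A[m]}]_m -> Prop) w :
  (forall w', (forall k, in_ideal (p%:R ^+ e :: G) (w' 0 k)) -> Q w') ->
  (forall c g, g \in G -> Q (c *: grad g)) ->
  (forall w1 w2, Q w1 -> Q w2 -> Q (w1 + w2)) ->
  in_forms p G e w -> Q w.
Proof.
move=> Q0 Qg QD [c h]; rewrite -(subrK (\sum_i c i *: grad G`_i) w).
apply: (QD); first exact: (Q0).
apply: (big_ind Q) => //; first by apply: Q0 => k; rewrite mxE; apply: in_ideal0.
by move=> i _; apply: Qg; apply: mem_nth.
Qed.

(** In d(a y) = a dy + y da the second term needs y itself in the ideal, hence an induction on both
    properties together. *)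
Lemma in_forms_grad e f : in_ideal (p%:R ^+ e :: G) f -> in_forms p G e (grad f).
Proof.
have hI : ideal_pred (fun h => in_ideal (p%:R ^+ e :: G) h /\ in_forms p G e (grad h)).
  split=> [|x y [Ix fx] [Iy fy]|x y [Iy fy]].
  - by split; [apply: in_ideal0|rewrite -[0]mpolyC0 gradC; apply: in_forms0].
  - by split; [apply: in_idealB|rewrite gradD gradN; apply: in_formsB].
  - split; first exact: in_idealM.
    rewrite gradM; apply: in_formsD; first exact: in_formsZ.
    exact: in_forms_scale.
move=> h; suff [] : in_ideal (p%:R ^+ e :: G) f /\ in_forms p G e (grad f) by [].
apply: (in_ideal_sub hI _ h) => g gG; split; first exact: in_ideal_mem.
move: gG; rewrite inE => /orP[/eqP ->|]; last exact: in_forms_grad_mem.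
by rewrite -natrX -mpolyC_nat gradC; apply: in_forms0.
Qed.

End FormFiltration.

(** * Operations on functions and forms, computed on arbitrary approximating sequences *)

Section FormOperations.
Variables (p : nat) (A : comNzRingType) (dA : A -> A).

Lemma jof_approx r (S : affine A) f : capprox (jof p dA (r := r) (S := S) f) (fun=> f).
Proof. by apply: cls_approx => e; rewrite subrr; apply: filt0. Qed.

Lemma evl_jof r (S : affine A) n (g : 'I_n -> {mpoly A[jdim (nv S) r]}) f :
  evl (fun k => jof p dA (r := r) (S := S) (g k)) f = jof p dA (subst g f).
Proof.
apply: capprox_eq (jof_approx (r := r) (S := S) (subst g f)) => e.
rewrite -(subrKA (subst (fun k => rep (jof p dA (r := r) (S := S) (g k)) e) f)).
apply: filtD; first exact: (evl_approx (fun k => jof p dA (r := r) (S := S) (g k))).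
apply: subst_approx => k; exact: (jof_approx (r := r) (S := S) (g k)).
Qed.

Lemma dJ_approx r (S : affine A) (b : J p dA r S) bs :
  capprox b bs -> capprox (dJ b) (fun e => grad (bs e)).
Proof.
move=> h e; rewrite -(subrKA (grad (rep b e))); apply: filtD; last first.
  by rewrite -gradN -gradD; apply: in_forms_grad; apply: h.
apply: cls_approx => e'; rewrite -gradN -gradD; apply: in_forms_grad.
exact: (rep_coh b).
Qed.

Lemma jscale_approx r (S : affine A) (b : J p dA r S) (w : Om p dA r S) bs ws :
  capprox b bs -> capprox w ws -> capprox (jscale b w) (fun e => bs e *: ws e).
Proof.
have key e f f' v v' : in_ideal (p%:R ^+ e :: jeqs p dA r S) (f - f') ->
    in_forms p (jeqs p dA r S) e (v - v') ->
    in_forms p (jeqs p dA r S) e (f *: v - f' *: v').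
  move=> hf hv; rewrite -(subrKA (f *: v')) -scalerBr -scalerBl.
  by apply: in_formsD; [apply: in_formsZ|apply: in_forms_scale].
move=> hb hw e; rewrite -(subrKA (rep b e *: rep w e)); apply: filtD; last first.
  by apply: key; [apply: hb|apply: hw].
by apply: cls_approx => e'; apply: key; [apply: (rep_coh b)|apply: (rep_coh w)].
Qed.

Section PullBack.
Variables (r q : nat) (S T : affine A) (v : 'I_(jdim (nv S) r) -> J p dA q T).
Hypothesis hv : forall g, g \in jeqs p dA r S -> evl v g = 0.
Local Notation s e := (fun k => rep (v k) e).

(** Coherence of a pull-back compares levels e and e + 1, so representatives of a finer level e'
    must be allowed at level e. *)
Lemma subst_in e e' f : (e <= e')%N ->
  in_ideal (p%:R ^+ e :: jeqs p dA r S) f ->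
  in_ideal (p%:R ^+ e :: jeqs p dA q T) (subst (s e') f).
Proof.
move=> le_e; have hI : ideal_pred
    (fun h => in_ideal (p%:R ^+ e :: jeqs p dA q T) (subst (s e') h)).
  split=> [|x y|x y]; first by rewrite subst0; apply: in_ideal0.
    by rewrite substB; apply: in_idealB.
  by rewrite substM; apply: in_idealM.
move=> hf; apply: (in_ideal_sub hI _ hf) => g; rewrite inE => /orP[/eqP ->|gS].
  by rewrite substXn subst_nat; apply: in_ideal_mem; rewrite inE eqxx.
have: in_ideal (p%:R ^+ e' :: jeqs p dA q T) (subst (s e') g).
  apply: (capprox_sub (evl_approx v g)); rewrite (hv gS).
  by have := capprox0 (adic_ifilt p (jeqs p dA q T)) e'; rewrite subr0.
apply: in_ideal_sub_seq => h; rewrite inE => /orP[/eqP ->|hT].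
  rewrite -(subnK le_e) exprD; apply: in_idealM.
  by apply: in_ideal_mem; rewrite inE eqxx.
by apply: in_ideal_mem; rewrite inE hT orbT.
Qed.

Lemma pull_approx b bs :
  capprox b bs -> capprox (pull v b) (fun e => subst (s e) (bs e)).
Proof.
move=> h e; rewrite -(subrKA (subst (s e) (rep b e))); apply: filtD; last first.
  by rewrite -substB; apply: subst_in (leqnn e) _; apply: h.
apply: cls_approx => {}e.
rewrite -(subrKA (subst (s e.+1) (rep b e))); apply: filtD.
  by rewrite -substB; apply: subst_in (leqnSn e) _; apply: (rep_coh b).
by apply: (@subst_approx _ _ _ (adic_ifilt p (jeqs p dA q T))) => k; apply: (rep_coh (v k)).
Qed.

Local Notation Fpull e w := (\sum_k subst (s e) (w 0 k) *: grad (rep (v k) e)).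

Lemma Fpull_in e e' w : (e <= e')%N ->
  in_forms p (jeqs p dA r S) e w -> in_forms p (jeqs p dA q T) e (Fpull e' w).
Proof.
move=> le_e; apply: (in_forms_ind
  (Q := fun w => in_forms p (jeqs p dA q T) e (Fpull e' w)))
  => [w' hw|c g gS|w1 w2 h1 h2].
- by apply: in_forms_sum => k; apply: in_forms_scale; apply: subst_in.
- rewrite (eq_bigr (fun k => subst (s e') c *: (subst (s e') g^`M(k) *: grad (rep (v k) e')))).
    rewrite -scaler_sumr -chain_rule; apply: in_formsZ; apply: in_forms_grad.
    by apply: subst_in => //; apply: in_ideal_mem; rewrite inE gS orbT.
  by move=> k _; rewrite !mxE substM scalerA.
- rewrite (eq_bigr (fun k => subst (s e') (w1 0 k) *: grad (rep (v k) e')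
     + subst (s e') (w2 0 k) *: grad (rep (v k) e'))).
    by rewrite big_split; exact: (in_formsD h1 h2).
  by move=> k _; rewrite mxE substD scalerDl.
Qed.

Lemma FpullB e (w w' : 'rV[{mpoly A[jdim (nv S) r]}]_(jdim (nv S) r)) : Fpull e (w - w') = Fpull e w - Fpull e w'.
Proof.
by rewrite -sumrB; apply: eq_bigr => k _; rewrite !mxE substB scalerBl.
Qed.

Lemma pull_form_approx (w : Om p dA r S) ws :
  capprox w ws -> capprox (pull_form v w) (fun e => Fpull e (ws e)).
Proof.
move=> h e; rewrite -(subrKA (Fpull e (rep w e))); apply: filtD; last first.
  by rewrite -FpullB; apply: Fpull_in (leqnn e) _; apply: h.
apply: cls_approx => {}e.
rewrite -(subrKA (Fpull e.+1 (rep w e))); apply: filtD.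
  by rewrite -FpullB; apply: Fpull_in (leqnSn e) (rep_coh w e).
rewrite -sumrB; apply: in_forms_sum => k.
rewrite -(subrKA (subst (s e.+1) (rep w e 0 k) *: grad (rep (v k) e))).
rewrite -scalerBr -scalerBl; apply: in_formsD.
  by apply: in_formsZ; rewrite -gradN -gradD; apply: in_forms_grad; apply: (rep_coh (v k)).
apply: in_forms_scale.
by apply: (@subst_approx _ _ _ (adic_ifilt p (jeqs p dA q T))) => k'; apply: (rep_coh (v k')).
Qed.

Lemma pull_jof f : pull v (jof p dA f) = evl v f.
Proof. exact: capprox_eq (pull_approx (jof_approx f)) (evl_approx v f). Qed.

Lemma pull_form_dJ b : pull_form v (dJ b) = dJ (pull v b).
Proof.
apply: capprox_eq (pull_form_approx (dJ_approx (capprox_rep b))) _.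
apply: eq_capprox (dJ_approx (pull_approx (capprox_rep b))) => e.
by rewrite chain_rule; apply: eq_bigr => k _; rewrite !mxE.
Qed.

Lemma pull_form_jscale f w :
  pull_form v (jscale (jof p dA f) w) = jscale (evl v f) (pull_form v w).
Proof.
have h := jscale_approx (jof_approx f) (capprox_rep w).
apply: capprox_eq (pull_form_approx h) _.
apply: eq_capprox (jscale_approx (evl_approx v f) (pull_form_approx (capprox_rep w))) => e.
by rewrite scaler_sumr; apply: eq_bigr => k _; rewrite !mxE substM scalerA.
Qed.

End PullBack.

End FormOperations.

(** * The divided Frobenius on forms *)

Section FrobeniusOnForms.
Variables (p : nat) (A : comNzRingType) (dA : A -> A).
Hypotheses (p_prime : prime p) (hdA : p_derivation p dA).
Hypothesis A_tf : forall x : A, p%:R * x = 0 -> x = 0.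

Lemma mpoly_torsion_free n (f : {mpoly A[n]}) : p%:R * f = 0 -> f = 0.
Proof.
move=> /mpolyP e; apply/mpolyP => k; rewrite mcoeff0; apply: A_tf.
by have := e k; rewrite mcoeff0 -mpolyC_nat mcoeffCM.
Qed.

Section Univ.
Variables n r : nat.
Local Notation P := {mpoly A[jdim n r]}.

(* phi^* / p of d y_k. *)
Definition frob_diff (k : 'I_(jdim n r)) : 'rV[{mpoly A[jdim n r.+1]}]_(jdim n r.+1) :=
  'X_(jwid k) ^+ p.-1 *: grad 'X_(jwid k) + grad 'X_(jshift k).

Definition frob_forms (w : 'rV[P]_(jdim n r)) : 'rV[{mpoly A[jdim n r.+1]}]_(jdim n r.+1) :=
  \sum_k phi_univ p dA (w 0 k) *: frob_diff k.

Lemma frob_formsD w w' : frob_forms (w + w') = frob_forms w + frob_forms w'.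
Proof.
rewrite -big_split; apply: eq_bigr => k _.
by rewrite mxE phi_univD // scalerDl.
Qed.

Lemma frob_formsZ f w : frob_forms (f *: w) = phi_univ p dA f *: frob_forms w.
Proof.
rewrite scaler_sumr; apply: eq_bigr => k _.
by rewrite mxE phi_univM // scalerA.
Qed.

Lemma frob_formsB w w' : frob_forms (w - w') = frob_forms w - frob_forms w'.
Proof.
rewrite -sumrB; apply: eq_bigr => k _.
by rewrite !mxE phi_univB // scalerBl.
Qed.

Lemma frob_forms0 : frob_forms 0 = 0.
Proof. by rewrite -[0](subrr 0) frob_formsB subrr. Qed.

Lemma frob_forms_gradX k : frob_forms (grad 'X_k) = frob_diff k.
Proof.
rewrite /frob_forms (bigD1 k) //= big1 => [|j /negbTE jk]; rewrite mxE mderivU.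
  by rewrite eqxx (phi_univ_nat hdA _ _ 1) scale1r addr0.
by rewrite eq_sym jk (phi_univ_nat hdA _ _ 0) scale0r.
Qed.

Lemma frob_forms_grad_mulp (f : P) :
  p%:R *: frob_forms (grad f) = grad (phi_univ p dA f).
Proof.
elim/mpoly_closed_ind: f => [x|k|f g IHf IHg|f g IHf IHg].
- by rewrite gradC frob_forms0 scaler0 phi_univC // gradC.
- rewrite frob_forms_gradX phi_univX // gradD gradX gradM -mpolyC_nat gradC.
  by rewrite scaler0 addr0 mpolyC_nat scalerDr scalerA mulr_natl.
- by rewrite gradD frob_formsD scalerDr IHf IHg phi_univD // gradD.
- rewrite gradM frob_formsD !frob_formsZ scalerDr phi_univM // gradM.
  move: (frob_forms (grad f)) (frob_forms (grad g)) IHf IHg => u v.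
  move: (phi_univ p dA f) (phi_univ p dA g) => a b <- <-.
  by rewrite !scalerA ![p%:R * _]mulrC.
Qed.

(** This is d(f^p + p delta f) divided by p, which is legitimate since polynomials over A have no
    p-torsion. *)
Lemma frob_forms_grad (f : P) :
  frob_forms (grad f) =
  jincl f ^+ p.-1 *: grad (jincl f) + grad (del_univ p dA f).
Proof.
apply/rowP => k; apply/eqP; rewrite -subr_eq0; apply/eqP.
apply: mpoly_torsion_free.
have := congr1 (fun w : 'rV_(jdim n r.+1) => w 0 k) (frob_forms_grad_mulp f).
rewrite phi_univE // gradD gradM gradX -mpolyC_nat gradC scaler0 addr0 !mxE mpolyC_nat.
by move=> e; rewrite mulrBr e -mulr_natl; ring.
Qed.

End Univ.

Section Affine.
Variable S : affine A.
Local Notation P := {mpoly A[jdim (nv S) 0]}.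

Lemma jeqs1_jincl g : g \in eqs S -> @jincl A (nv S) 0 g \in jeqs p dA 1 S.
Proof. by move=> gS; rewrite mem_cat map_f. Qed.

Lemma jeqs1_del g : g \in eqs S -> @del_univ p A dA (nv S) 0 g \in jeqs p dA 1 S.
Proof. by move=> gS; rewrite mem_cat (map_f (@del_iter p A dA (nv S) 1)) ?orbT. Qed.

(** An equation g goes to g^p + p delta g, and both g and delta g are equations of the first jet
    space. *)
Lemma phi_univ_in e (f : P) :
  in_ideal (p%:R ^+ e :: jeqs p dA 0 S) f ->
  in_ideal (p%:R ^+ e :: jeqs p dA 1 S) (phi_univ p dA f).
Proof.
have hI : ideal_pred (fun h : P =>
    in_ideal (p%:R ^+ e :: jeqs p dA 1 S) (phi_univ p dA h)).
  split=> [|x y|x y]; first by rewrite (phi_univ_nat hdA _ _ 0); apply: in_ideal0.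
    by rewrite phi_univB //; apply: in_idealB.
  by rewrite phi_univM //; apply: in_idealM.
move=> hf; apply: (in_ideal_sub hI _ hf) => g; rewrite inE => /orP[/eqP ->|gS].
  have -> : phi_univ p dA (p%:R ^+ e : P) = p%:R ^+ e.
    by rewrite -!natrX (phi_univ_nat hdA).
  by apply: in_ideal_mem; rewrite inE eqxx.
rewrite phi_univE //; apply: (ideal_predD (in_ideal_pred _)).
  have -> : @jincl A (nv S) 0 g ^+ p = jincl g ^+ p.-1 * jincl g.
    by rewrite -exprSr prednK // prime_gt0.
  apply: in_idealM.
  by apply: in_ideal_mem; rewrite inE; apply/orP; right; apply: jeqs1_jincl.
apply: in_idealM.
by apply: in_ideal_mem; rewrite inE; apply/orP; right; apply: jeqs1_del.
Qed.

Lemma frob_forms_in e w :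
  in_forms p (jeqs p dA 0 S) e w -> in_forms p (jeqs p dA 1 S) e (frob_forms w).
Proof.
apply: (in_forms_ind (Q := fun w => in_forms p (jeqs p dA 1 S) e (frob_forms w)))
  => [w' hw|c g gS|w1 w2 h1 h2].
- by apply: in_forms_sum => k; apply: in_forms_scale; apply: phi_univ_in.
- rewrite frob_formsZ frob_forms_grad; apply: in_formsZ; apply: in_formsD.
    by apply: in_formsZ; apply: in_forms_grad_mem; apply: jeqs1_jincl.
  by apply: in_forms_grad_mem; apply: jeqs1_del.
- by rewrite frob_formsD; exact: (in_formsD h1 h2).
Qed.

Lemma phi_form_approx (w : Om p dA 0 S) :
  capprox (phi_form w) (fun e => frob_forms (rep w e)).
Proof.
apply: cls_approx => e; rewrite -/(frob_forms _) -/(frob_forms _) -frob_formsB.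
by apply: frob_forms_in; apply: (rep_coh w).
Qed.

End Affine.

End FrobeniusOnForms.

(** * The section of the jet spaces attached to a flow *)

Section FlowSection.
Variables (p : nat) (A : comNzRingType) (dA : A -> A).
Hypotheses (p_prime : prime p) (hdA : p_derivation p dA).
Variables (S : affine A) (d : J p dA 0 S -> J p dA 0 S).
Hypothesis hd : flow d.
Hypothesis B_tf : forall x : J p dA 0 S, p%:R * x = 0 -> x = 0.
Local Notation sg r := (@sig p A dA S d r).

Lemma frobD x y : frob p d (x + y) = frob p d x + frob p d y.
Proof.
have [[hz _] _] := hd; have h0 : frob p d 0 = 0 by have := hz 0 0; rewrite !subrr.
by rewrite -{1}[y]opprK hz -[- y]sub0r hz h0 sub0r opprK.
Qed.

Lemma frobM x y : frob p d (x * y) = frob p d x * frob p d y.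
Proof. by have [[_ [_ hm]] _] := hd. Qed.

Lemma flow0 : d 0 = 0.
Proof.
apply: B_tf; have [[hz _] _] := hd; have := hz 0 0.
by rewrite !subrr /frob expr0n gtn_eqF ?prime_gt0 // add0r.
Qed.

Lemma sigS r k : sg r.+1 k =
  match split k with inl i => @jX p A dA 0 S i | inr l => d (sg r l) end.
Proof. by []. Qed.

(** [sig] recurses by splitting off the first block of coordinates and applying [d] to the rest;
    agreement on the initial blocks therefore takes an induction on r. *)
Lemma sig_jwid r k : sg r.+1 (jwid k) = sg r k.
Proof.
elim: r k => [|r IH] k.
  rewrite /=; case: splitP => j /= e; first by congr (@jX p A dA 0 S _); apply/val_inj.
  by have := ltn_ord k; rewrite /= e ltnNge leq_addr.
rewrite (sigS (jwid k)) (sigS k).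
case: (splitP (jwid k)) => j; case: (splitP k) => j' e' e.
- by congr (@jX p A dA 0 S _); apply/val_inj; rewrite /= -e' -e.
- by have := ltn_ord j; rewrite -e /= e' ltnNge leq_addr.
- by have := ltn_ord j'; rewrite -e' -[nat_of_ord k]/(nat_of_ord (jwid k)) e ltnNge leq_addr.
- rewrite -IH; congr (d (sg r.+1 _)); apply/val_inj/(@addnI (nv S)).
  by rewrite -e /= e'.
Qed.

Lemma sig_jshift r k : sg r.+1 (jshift k) = d (sg r k).
Proof.
rewrite /=; case: splitP => j /= e; last by congr (d (sg r _)); apply/val_inj/(@addnI (nv S)).
by have := ltn_ord j; rewrite -e ltnNge leq_addr.
Qed.

Lemma evl_sig_jincl r f : evl (sg r.+1) (jincl f) = evl (sg r) f.
Proof.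
congr cls; apply/funext => e; rewrite /jincl subst_subst; congr subst.
by apply/funext => k; rewrite substX sig_jwid.
Qed.

Lemma evl_sig_phi r f : evl (sg r.+1) (phi_univ p dA f) = frob p d (evl (sg r) f).
Proof.
elim/mpoly_closed_ind: f => [x|k|f g IHf IHg|f g IHf IHg].
- by rewrite phi_univC // !evlC; have [_ ->] := hd.
- rewrite phi_univX // evlD evlXn evlM evl_nat (evlX (sg r)) !(evlX (sg r.+1)).
  by rewrite sig_jwid sig_jshift.
- by rewrite (phi_univD hdA f g) (evlD (sg r.+1)) (evlD (sg r)) IHf IHg frobD.
- by rewrite (phi_univM hdA f g) (evlM (sg r.+1)) (evlM (sg r)) IHf IHg frobM.
Qed.

(** Evaluation commutes with the two Frobenius lifts, and torsion-freeness lets one divide the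
    difference with the p-th power by p. *)
Lemma evl_sig_del r f : evl (sg r.+1) (del_univ p dA f) = d (evl (sg r) f).
Proof.
apply/eqP; rewrite -subr_eq0; apply/eqP; apply: B_tf.
rewrite mulrBr -(evl_nat (sg r.+1)) -evlM del_univE // evlB evlXn evl_sig_phi.
by rewrite evl_sig_jincl evl_nat /frob [_ ^+ p + _]addrC addrK subrr.
Qed.

Lemma jof_eqs r g : g \in jeqs p dA r S -> jof p dA (r := r) (S := S) g = 0.
Proof.
move=> gS; apply: adic_limit_eq0 => e.
have := jof_approx p dA (r := r) (S := S) g e => h.
rewrite -[rep _ e](subrK g); apply: (ideal_predD (in_ideal_pred _)) => //.
by apply: in_ideal_mem; rewrite inE gS orbT.
Qed.

Lemma evl_sig0 f : evl (sg 0) f = jof p dA f.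
Proof. by rewrite -{2}[f]subst_id -evl_jof. Qed.

(** The q-th derivative of an equation goes to the q-fold [d] of 0, which is 0. *)
Lemma evl_sig_jeqs r g : g \in jeqs p dA r S -> evl (sg r) g = 0.
Proof.
have del_eqs q f : f \in eqs S -> evl (sg q) (del_iter p dA q f) = 0.
  move=> fS; elim: q => [|q IH]; first by rewrite evl_sig0 (jof_eqs (r := 0)).
  by rewrite /= evl_sig_del IH flow0.
elim: r g => [|r IH] g; first by apply: (del_eqs 0).
rewrite /= mem_cat => /orP[/mapP [h hS ->]|/mapP [h hS ->]].
  by rewrite evl_sig_jincl IH.
exact: (del_eqs r.+1).
Qed.

End FlowSection.
(** * Reduction modulo p *)

Section Reduction.
Variables (p : nat) (A : comNzRingType) (dA : A -> A).
Hypotheses (p_prime : prime p) (hdA : p_derivation p dA).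
Hypothesis A_tf : forall x : A, p%:R * x = 0 -> x = 0.
Variables (S : affine A) (d : J p dA 0 S -> J p dA 0 S).
Hypothesis hd : flow d.
Hypothesis B_tf : forall x : J p dA 0 S, p%:R * x = 0 -> x = 0.
Variables (K : fieldType) (iota : {rmorphism J p dA 0 S -> K}).
Hypothesis iota_frac : is_frac_mod p iota.
Local Notation sg r := (@sig p A dA S d r).
Local Notation P r := {mpoly A[jdim (nv S) r]}.

Definition red_pol (f : {mpoly A[nv S]}) : K := iota (jof p dA (r := 0) (S := S) f).

Lemma red_pol_evl f : red_pol f = iota (evl (@jX p A dA 0 S) f).
Proof. by rewrite /red_pol -[in LHS](subst_id f) -evl_jof. Qed.

Lemma red_pol_zmod : zmod_morphism red_pol.
Proof. by move=> f g; rewrite !red_pol_evl evlB rmorphB. Qed.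

Lemma red_pol_monoid : monoid_morphism red_pol.
Proof.
split; first by rewrite red_pol_evl (evl_nat (@jX p A dA 0 S) 1) rmorph1.
by move=> f g; rewrite !red_pol_evl evlM rmorphM.
Qed.

Definition red_hom : {rmorphism {mpoly A[nv S]} -> K} := HB.pack red_pol
  (GRing.isZmodMorphism.Build _ _ red_pol red_pol_zmod)
  (GRing.isMonoidMorphism.Build _ _ red_pol red_pol_monoid).
Local Notation red := red_hom.

Definition red_const : {rmorphism A -> K} := red \o @mpolyC _ A.
Local Notation cst := red_const.

Lemma pK0 : p%:R = 0 :> K.
Proof.
rewrite -(rmorph_nat iota); apply/(proj1 iota_frac).
by exists 1; rewrite expr1 mulr1.
Qed.

Lemma charK : p \in [pchar K].
Proof. by rewrite inE p_prime pK0 eqxx. Qed.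

Local Notation Fr := (pFrobenius_aut charK).
Local Notation "q ^Fr" := (map_poly Fr q) (at level 2, format "q ^Fr").

(** The difference of [b] and its first representative vanishes at level 1, so it is divisible by p
    in the limit. *)
Lemma iota_rep b : iota b = red (rep b 1).
Proof.
apply/eqP; rewrite -subr_eq0 -rmorphB; apply/eqP/(proj1 iota_frac).
apply: pmul_adic_limit.
have h := capproxD (capprox_rep b) (capproxN (jof_approx p dA (r := 0) (S := S) (rep b 1))).
by rewrite -[rep _ 1]subr0 -(subrr (rep b 1)); apply: h.
Qed.

(** With this kernel, a derivation on polynomials descends to K once it is checked on p and on the
    equations. *)
Lemma red_eq0 f : red f = 0 <-> in_ideal (p%:R ^+ 1 :: eqs S) f.
Proof.
split=> [/(proj1 iota_frac) [y e]|].
  have h := capproxM (capproxX 1 (capprox_nat _ p)) (capprox_rep y).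
  have := jof_approx p dA (r := 0) (S := S) f 1; rewrite e => h'.
  have := filtB (h 1) h'; rewrite opprB addrC subrKA => h2.
  rewrite -(subrK (p%:R ^+ 1 * rep y 1) f); apply: (ideal_predD (in_ideal_pred _)) => //.
  by rewrite mulrC; apply: in_idealM; apply: in_ideal_mem; rewrite inE eqxx.
have hI : ideal_pred (fun f => red f = 0).
  split=> [|x y|x y]; first exact: rmorph0.
    by rewrite rmorphB => -> ->; rewrite subrr.
  by rewrite rmorphM => ->; rewrite mulr0.
move=> hf; apply: (in_ideal_sub hI _ hf) => g; rewrite inE => /orP[/eqP ->|gS].
  by rewrite rmorphXn rmorph_nat pK0 expr1.
by rewrite /= /red_pol (jof_eqs (r := 0)) ?rmorph0.
Qed.

(** Pull-back along sigma followed by reduction mod p, defined through [mmap] so as to be a ring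
    morphism by construction. *)
Definition jet_val r : {rmorphism P r -> K} := mmap cst (fun k => iota (sg r k)).

Lemma jet_valE r f : jet_val r f = iota (evl (sg r) f).
Proof.
elim/mpoly_closed_ind: f => [x|k|f g IHf IHg|f g IHf IHg].
- by rewrite [LHS]mmapC evlC.
- by rewrite [LHS]mmapU evlX.
- by rewrite (rmorphD (jet_val r)) IHf IHg evlD rmorphD.
- by rewrite (rmorphM (jet_val r)) IHf IHg evlM rmorphM.
Qed.

Lemma jet_val0 f : jet_val 0 f = red f.
Proof. by rewrite jet_valE [RHS]red_pol_evl. Qed.

Lemma jet_val_in r f :
  in_ideal (p%:R ^+ 1 :: jeqs p dA r S) f -> jet_val r f = 0.
Proof.
have hI : ideal_pred (fun f => jet_val r f = 0).
  split=> [|x y|x y]; first exact: rmorph0.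
    by rewrite (rmorphB (jet_val r)) => -> ->; rewrite subrr.
  by rewrite (rmorphM (jet_val r)) => ->; rewrite mulr0.
move=> hf; apply: (in_ideal_sub hI _ hf) => g; rewrite inE => /orP[/eqP ->|gS].
  by rewrite (rmorphXn (jet_val r)) (rmorph_nat (jet_val r)) pK0 expr1.
by rewrite jet_valE (evl_sig_jeqs p_prime hdA hd B_tf gS) rmorph0.
Qed.

Lemma jet_val_jincl r f : jet_val r.+1 (jincl f) = jet_val r f.
Proof. by rewrite !jet_valE evl_sig_jincl. Qed.

Lemma jet_val_phi r f : jet_val r.+1 (phi_univ p dA f) = jet_val r f ^+ p.
Proof.
rewrite !jet_valE evl_sig_phi // /frob rmorphD rmorphXn rmorphM rmorph_nat.
by rewrite pK0 mul0r addr0.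
Qed.

Variable D : K -> K.
Hypotheses (hD : twisted_der idfun D) (D_cst : forall x, D (cst x) = 0).

(** The contraction with D of the pull-back of the form along sigma, reduced mod p. *)
Definition pair_forms r (w : 'rV[P r]_(jdim (nv S) r)) : K :=
  \sum_k jet_val r (w 0 k) * D (iota (sg r k)).

Lemma pair_formsD r w w' : pair_forms (r := r) (w + w') = pair_forms w + pair_forms w'.
Proof.
rewrite -big_split; apply: eq_bigr => k _.
by rewrite mxE (rmorphD (jet_val r)) mulrDl.
Qed.

Lemma pair_formsZ r f w : pair_forms (r := r) (f *: w) = jet_val r f * pair_forms w.
Proof.
rewrite mulr_sumr; apply: eq_bigr => k _.
by rewrite mxE (rmorphM (jet_val r)) mulrA.
Qed.

Lemma pair_forms0 r : pair_forms (r := r) 0 = 0.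
Proof. by rewrite -(scale0r 0) pair_formsZ (rmorph0 (jet_val r)) mul0r. Qed.

Lemma pair_formsN r w : pair_forms (r := r) (- w) = - pair_forms w.
Proof. by rewrite -scaleN1r pair_formsZ (rmorphN1 (jet_val r)) mulN1r. Qed.

Lemma pair_forms_sum r (I : Type) (s : seq I) (F : I -> 'rV[P r]_(jdim (nv S) r)) :
  pair_forms (\sum_(i <- s) F i) = \sum_(i <- s) pair_forms (F i).
Proof.
apply: (big_morph (pair_forms (r := r))); [exact: pair_formsD|exact: pair_forms0].
Qed.

Lemma pair_forms_grad r f : pair_forms (grad f) = D (jet_val r f).
Proof.
elim/mpoly_closed_ind: f => [x|k|f g IHf IHg|f g IHf IHg].
- by rewrite gradC pair_forms0 [jet_val r _]mmapC D_cst.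
- rewrite /pair_forms (bigD1 k) //= big1 => [|j /negbTE jk]; rewrite mxE mderivU.
    by rewrite eqxx (rmorph1 (jet_val r)) mul1r addr0 [mmap _ _ _](mmapU cst).
  by rewrite eq_sym jk (rmorph0 (jet_val r)) mul0r.
- by rewrite gradD pair_formsD IHf IHg (rmorphD (jet_val r)) (proj1 hD).
- by rewrite gradM pair_formsD !pair_formsZ IHf IHg (rmorphM (jet_val r)) (proj2 hD).
Qed.

(** The contraction factors through level 1, so it is defined on the limit and may be read off any
    approximating sequence. *)
Lemma pair_forms_in r w : in_forms p (jeqs p dA r S) 1 w -> pair_forms w = 0.
Proof.
apply: (in_forms_ind (Q := fun w => pair_forms (r := r) w = 0)) => [w' hw|c g gS|w1 w2 h1 h2].
- by rewrite /pair_forms big1 // => k _; rewrite jet_val_in // mul0r.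
- rewrite pair_formsZ pair_forms_grad (@jet_val_in r g); last first.
    by apply: in_ideal_mem; rewrite inE gS orbT.
  by rewrite (twisted_der0 hD) mulr0.
- by rewrite pair_formsD h1 h2 addr0.
Qed.

(* The value mod p of sigma^* w on the derivation D of the function field. *)
Definition pair r (w : Om p dA r S) : K := pair_forms (rep w 1).

Lemma pair_approx r (w : Om p dA r S) ws : capprox w ws -> pair w = pair_forms (ws 1).
Proof.
move=> h; apply/eqP; rewrite -subr_eq0 -pair_formsN -pair_formsD; apply/eqP.
by apply: pair_forms_in; apply: h.
Qed.

Lemma pairD r (w w' : Om p dA r S) : pair (w + w') = pair w + pair w'.
Proof. by rewrite (pair_approx (capproxD (capprox_rep w) (capprox_rep w'))) pair_formsD. Qed.

Lemma pairB r (w w' : Om p dA r S) : pair (w - w') = pair w - pair w'.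
Proof.
rewrite pairD (pair_approx (capproxN (capprox_rep w'))).
by rewrite pair_formsN.
Qed.

Lemma pair_mulrp r (w : Om p dA r S) : pair (w *+ p) = 0.
Proof.
rewrite (pair_approx (capproxMn p (capprox_rep w))) -scaler_nat pair_formsZ.
by rewrite (rmorph_nat (jet_val r)) pK0 mul0r.
Qed.

Lemma pair_jscale r f (w : Om p dA r S) :
  pair (jscale (jof p dA f) w) = jet_val r f * pair w.
Proof.
by rewrite (pair_approx (jscale_approx (jof_approx p dA f) (capprox_rep w))) pair_formsZ.
Qed.

Lemma pair_ascale r x (w : Om p dA r S) : pair (ascale x w) = cst x * pair w.
Proof. by rewrite pair_jscale [jet_val r _]mmapC. Qed.

Lemma jet_val_subst r q (v : 'I_(jdim (nv S) r) -> J p dA q S) f :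
  (forall k, jet_val q (rep (v k) 1) = iota (sg r k)) ->
  jet_val q (subst (fun k => rep (v k) 1) f) = jet_val r f.
Proof.
move=> hv; elim/mpoly_closed_ind: f => [x|k|f g IHf IHg|f g IHf IHg].
- by rewrite substC [LHS]mmapC [RHS]mmapC.
- by rewrite substX hv [RHS]mmapU.
- by rewrite substD (rmorphD (jet_val q)) (rmorphD (jet_val r)) IHf IHg.
- by rewrite substM (rmorphM (jet_val q)) (rmorphM (jet_val r)) IHf IHg.
Qed.

(** Contraction is unchanged by pull-back along any [v] matching the two sections mod p. This covers
    both the inclusions between jet levels and the passage from [phi_form] to [frob_form]. *)
Lemma pair_pull_form r q (v : 'I_(jdim (nv S) r) -> J p dA q S) (w : Om p dA r S) :
  (forall g, g \in jeqs p dA r S -> evl v g = 0) ->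
  (forall k, jet_val q (rep (v k) 1) = iota (sg r k)) ->
  pair (pull_form v w) = pair w.
Proof.
move=> h0 hv; rewrite (pair_approx (pull_form_approx h0 (capprox_rep w))) pair_forms_sum.
apply: eq_bigr => k _.
by rewrite pair_formsZ pair_forms_grad jet_val_subst // hv.
Qed.

Lemma jet_val_rep_jX r k : jet_val r (rep (@jX p A dA r S k) 1) = iota (sg r k).
Proof.
have := jet_val_in (jof_approx p dA (r := r) (S := S) 'X_k 1).
rewrite (rmorphB (jet_val r)) => /eqP; rewrite subr_eq0 => /eqP ->.
by rewrite [LHS]mmapU.
Qed.

Lemma evl_jX_jwid r g : g \in jeqs p dA r S ->
  evl (fun k => @jX p A dA r.+1 S (jwid k)) g = 0.
Proof.
move=> gS; rewrite -(jof_eqs (r := r.+1) (g := jincl g)); last first.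
  by rewrite /= mem_cat map_f.
exact: (@evl_jof p A dA r.+1 S _ (fun k => 'X_(jwid k))).
Qed.

Lemma pair_incl_form r (w : Om p dA r S) : pair (incl_form w) = pair w.
Proof.
apply: pair_pull_form => [g|k]; first exact: evl_jX_jwid.
by rewrite jet_val_rep_jX sig_jwid.
Qed.

Lemma pair_frob_form (w : Om p dA 0 S) : pair (frob_form d w) = pair (phi_form w).
Proof.
apply: pair_pull_form => [g|k]; first exact: evl_sig_jeqs.
by rewrite jet_val0 -iota_rep.
Qed.

Lemma iota_sig_pull r b : iota (sig_pull d (r := r) b) = jet_val r (rep b 1).
Proof.
have h0 g (gS : g \in jeqs p dA r S) := evl_sig_jeqs p_prime hdA hd B_tf gS.
have := jet_val_in (r := 0) (pull_approx h0 (capprox_rep b) 1).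
rewrite (rmorphB (jet_val 0)) => /eqP; rewrite subr_eq0 => /eqP e.
rewrite iota_rep -jet_val0 e jet_val_subst // => k.
by rewrite jet_val0 -iota_rep.
Qed.

Lemma pair_dJ r b : pair (dJ (r := r) b) = D (iota (sig_pull d b)).
Proof. by rewrite (pair_approx (dJ_approx (capprox_rep b))) pair_forms_grad iota_sig_pull. Qed.

Lemma pair_dJ_jof f : pair (dJ (jof p dA (r := 0) (S := S) f)) = D (red f).
Proof.
by rewrite (pair_approx (dJ_approx (jof_approx p dA f))) pair_forms_grad jet_val0.
Qed.

(** The divided Frobenius of df contracted with D, as a function of f. *)
Let frob_pair (f : {mpoly A[nv S]}) : K :=
  pair_forms (r := 1) (@frob_forms p A dA (nv S) 0 (grad f)).

Let frob_pairE f : frob_pair f = red f ^+ p.-1 * D (red f) + D (iota (d (jof p dA (r := 0) (S := S) f))).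
Proof.
rewrite /frob_pair frob_forms_grad // pair_formsD pair_formsZ !pair_forms_grad //.
rewrite (rmorphXn (jet_val 1)) !(jet_val_jincl (r := 0)) !jet_val0.
by rewrite [jet_val 1 _]jet_valE (evl_sig_del p_prime hdA hd B_tf) evl_sig0.
Qed.

Let pair_frob_forms (w : 'rV[P 0]_(jdim (nv S) 0)) :
  pair_forms (r := 1) (frob_forms p dA w) =
  \sum_k Fr (red (w 0 k)) * pair_forms (frob_diff p A k).
Proof.
rewrite [LHS]pair_forms_sum; apply: eq_bigr => k _.
by rewrite pair_formsZ (jet_val_phi (r := 0)) jet_val0 -(pFrobenius_autE charK).
Qed.

Let frob_pair_tangent f :
  frob_pair f = tangent (Fr \o red) (fun k => pair_forms (@frob_diff p A (nv S) 0 k)) f.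
Proof. by rewrite /frob_pair pair_frob_forms; apply: eq_bigr => k _; rewrite mxE. Qed.

Let frob_pair_der : twisted_der (Fr \o red) frob_pair.
Proof.
have [hadd hmul] := tangent_der (Fr \o red) (fun k => pair_forms (@frob_diff p A (nv S) 0 k)).
by split=> f g; rewrite !frob_pair_tangent ?hadd ?hmul.
Qed.

(** It suffices to test p, whose differential is 0, and an equation g: its reduction is 0, and delta
    g goes to [d] of 0. *)
Let frob_pair_ker f : red f = 0 -> frob_pair f = 0.
Proof.
move=> /red_eq0 hf.
have hI : ideal_pred (fun f => red f = 0 /\ frob_pair f = 0).
  split=> [|x y [rx fx] [ry fy]|x y [ry fy]].
  - by rewrite rmorph0 (twisted_der0 frob_pair_der).
  - by rewrite rmorphB rx ry (twisted_derB frob_pair_der) fx fy subrr.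
  - have Fry : (Fr \o red) y = 0 by rewrite -[LHS]/(Fr (red y)) ry rmorph0.
    by rewrite rmorphM ry mulr0 (proj2 frob_pair_der) fy Fry mulr0 mul0r addr0.
suff [] : red f = 0 /\ frob_pair f = 0 by [].
apply: (in_ideal_sub hI _ hf) => g gI.
have rg : red g = 0 by apply/red_eq0; apply: in_ideal_mem.
split=> //; move: gI; rewrite inE => /orP[/eqP ->|gS].
  rewrite expr1 /frob_pair -mpolyC_nat gradC (frob_forms0 hdA).
  exact: pair_forms0.
rewrite frob_pairE rg (jof_eqs (r := 0)) // (flow0 p_prime hd B_tf) rmorph0.
by rewrite (twisted_der0 hD) mulr0 addr0.
Qed.

Variable x : K.
Hypothesis Dx : D x != 0.
Hypothesis span : forall z, exists q, z = (q^Fr).[x].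

(* Since K = K^p(x), the divided Frobenius is determined on all 1-forms of K by its
   value on dx. *)
Lemma frob_pair_factor : exists rho,
  (forall f, frob_pair f = rho * D (red f) ^+ p) /\
  (forall w : Om p dA 0 S, pair (phi_form w) = rho * pair w ^+ p).
Proof.
have red_frac z : exists f g, red g != 0 /\ z = red f / red g.
  have [b [b' [nz ->]]] := proj2 iota_frac z.
  by exists (rep b 1), (rep b' 1); rewrite -!iota_rep.
have [E [hE E_red]] := fraction_der frob_pair_der frob_pair_ker red_frac.
(* Forced by z = x. For general z = [q^Fr] at x, both E z and (D z)^p acquire the same factor, the
   p-th power of the derivative of q evaluated likewise. *)
pose rho := E x / D x ^+ p.
have rhoE z : E z = rho * D z ^+ p.
  have [q ->] := span z.
  rewrite !(twisted_der_frob_horner _ _ _ hE) !(twisted_der_frob_horner _ _ _ hD) /=.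
  by rewrite exprMn pFrobenius_autE /rho mulrCA divfK // expf_neq0.
exists rho; split=> [f|w]; first by rewrite -E_red rhoE.
rewrite (pair_approx (phi_form_approx p_prime hdA A_tf w)).
rewrite pair_frob_forms -[X in rho * X](pFrobenius_autE charK) rmorph_sum mulr_sumr.
apply: eq_bigr => k _; rewrite (rmorphM Fr) jet_val0 mulrCA; congr (_ * _).
by rewrite -(frob_forms_gradX hdA) -[LHS]/(frob_pair 'X_k) -E_red rhoE.
Qed.

Let pair_comb r (c1 c2 c3 : A) (u1 u2 u3 : Om p dA r S) :
  pair (ascale c1 u1 + ascale c2 u2 + ascale c3 u3) =
  cst c1 * pair u1 + cst c2 * pair u2 + cst c3 * pair u3.
Proof.
apply: etrans (pairD _ _) _; congr (_ + _); last exact: pair_ascale.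
by apply: etrans (pairD _ _) _; congr (_ + _); apply: pair_ascale.
Qed.

(** The core argument, free of the curve: it asks only for a torsion-free completion, K = K^p(x),
    and a form with contraction 1. *)
Theorem canonical_pullback_is_pth_power (w : Om p dA 0 S) (eta : Om p dA 0 S)
    (b : J p dA 2 S) (h l0 l1 : A) :
  pair w = 1 ->
  frob_form d w - ascale h w = eta *+ p ->
  dJ b = ascale p%:R (phi_form (phi_form w)) + ascale l1 (incl_form (phi_form w))
         + ascale l0 (incl_form (incl_form w)) ->
  exists z, z ^+ p = iota (sig_pull d b).
Proof.
move=> w1 hw hb; have [rho [rhoE rho_phi]] := frob_pair_factor.
have rho_h : rho = cst h.
  move/(congr1 (pair (r := 0))): hw.
  rewrite pairB // pair_mulrp // pair_frob_form // rho_phi pair_ascale // w1.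
  by rewrite expr1n !mulr1 => /eqP; rewrite subr_eq0 => /eqP.
set f := iota _; pose m := l1 * h + l0.
have Df : D f = cst m.
  rewrite -(@pair_dJ 2) hb; apply: etrans (pair_comb _ _ _ _ _ _) _.
  have e1 : pair (incl_form (phi_form w)) = cst h.
    by apply: etrans (pair_incl_form _) _; rewrite rho_phi w1 expr1n mulr1.
  have e2 : pair (incl_form (incl_form w)) = 1.
    by do 2?[apply: etrans (pair_incl_form _) _].
  apply: etrans (congr2 (fun u v => _ + cst l1 * u + cst l0 * v) e1 e2) _.
  by rewrite (rmorph_nat cst) pK0 mul0r add0r mulr1 (rmorphD cst) (rmorphM cst).
have [m0|m0] := eqVneq (cst m) 0.
  by apply: (der_eq0_pexp hD Dx span); rewrite Df.
have DcstV y : D (cst y)^-1 = 0.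
  have [->|y0] := eqVneq (cst y) 0; first by rewrite invr0 (twisted_der0 hD).
  have := twisted_der1 hD; rewrite -(divff y0) (proj2 hD) D_cst mulr0 addr0 => /eqP.
  by rewrite mulf_eq0 (negbTE y0) => /eqP.
pose g := f / cst m.
have Dg : D g = 1 by rewrite (proj2 hD) DcstV mulr0 add0r Df /= mulVf.
(* Computing E at a polynomial lift of f in two ways gives rho m^p = f^(p-1) m + D s, with s the
   reduction of delta of the lift. *)
have := frob_pairE (rep (sig_pull d b) 1).
rewrite rhoE -iota_rep // -/f Df; move: (iota (d _)) => s ht.
(* As rho and m are constants, D of this is rho - (rho m^p - f^(p-1) m) / m^p = g^(p-1). *)
pose h' := rho * g - s / cst m ^+ p.
case: (@pred_exp_not_exact _ _ charK D x hD span g h' Dg).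
have mp0 : cst m ^+ p != 0 by rewrite expf_neq0.
have Dmp : D (cst m ^+ p)^-1 = 0 by rewrite -(rmorphXn cst) DcstV.
rewrite (twisted_derB hD) (proj2 hD rho g) (proj2 hD s) Dmp Dg.
rewrite {2}rho_h D_cst !mulr0 addr0 add0r mulr1.
have -> : D s = rho * cst m ^+ p - f ^+ p.-1 * cst m by rewrite ht addrC addKr.
have eM : cst m ^+ p = cst m * cst m ^+ p.-1.
  by rewrite -exprS prednK // prime_gt0.
rewrite eM /g expr_div_n; have : cst m ^+ p.-1 != 0 by rewrite expf_neq0.
move: (cst m ^+ p.-1) => v v0; move: (f ^+ p.-1) (cst m) m0 => u M M0 /=.
by field; rewrite M0 v0.
Qed.

End Reduction.
(** * The function field of the curve *)

Section PSpan.
Variables (p : nat) (K : fieldType) (charK : p \in [pchar K]) (x : K).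
Local Notation Fr := (pFrobenius_aut charK).
Local Notation "q ^Fr" := (map_poly Fr q) (at level 2, format "q ^Fr").

Definition pspan (z : K) := exists q, z = (q^Fr).[x].

Lemma pspan_gen : pspan x. Proof. by exists 'X; rewrite map_polyX hornerX. Qed.

Lemma pspan_pexp z : pspan (z ^+ p).
Proof. by exists z%:P; rewrite map_polyC hornerC. Qed.

Lemma pspanD z w : pspan z -> pspan w -> pspan (z + w).
Proof. by move=> [q ->] [r ->]; exists (q + r); rewrite rmorphD hornerD. Qed.

Lemma pspanM z w : pspan z -> pspan w -> pspan (z * w).
Proof. by move=> [q ->] [r ->]; exists (q * r); rewrite rmorphM hornerM. Qed.

Lemma pspanX z n : pspan z -> pspan (z ^+ n).
Proof.
move=> Lz; elim: n => [|n IH]; first by rewrite expr0 -(expr1n _ p); apply: pspan_pexp.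
by rewrite exprS; apply: pspanM.
Qed.

(** Since 1/z = z^(p-1) (1/z)^p, the ring K^p[x] is already a field. *)
Lemma pspanV z : pspan z -> pspan z^-1.
Proof.
move=> Lz; have [->|z0] := eqVneq z 0.
  by rewrite invr0; exists 0; rewrite rmorph0 horner0.
have p0 : (0 < p)%N by apply: prime_gt0; apply: pcharf_prime charK.
have -> : z^-1 = z ^+ p.-1 * z^-1 ^+ p.
  rewrite exprVn; apply: (mulIf (expf_neq0 p z0)); rewrite divfK ?expf_neq0 //.
  by rewrite -{1}(prednK p0) exprS mulKf.
by apply: pspanM; [apply: pspanX|apply: pspan_pexp].
Qed.

(** As p is odd, z is the quotient of z^p by a power of z^2. *)
Lemma pspan_sqrt z : odd p -> z != 0 -> pspan (z ^+ 2) -> pspan z.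
Proof.
move=> p_odd z0 Lz2; have -> : z = z ^+ p / (z ^+ 2) ^+ p./2.
  rewrite -exprM mul2n -{1}(odd_double_half p) p_odd exprD expr1 mulfK //.
  by rewrite expf_neq0.
by apply: pspanM; [apply: pspan_pexp|apply/pspanV/pspanX].
Qed.

End PSpan.

Lemma quadrics_solve (F : fieldType) (e0 e1 e2 u v x y z : F) : e0 - e1 != 0 ->
  e0 * x + e1 * y + e2 * z = u -> x + y + z = v ->
  x = (u - e1 * v + (e1 - e2) * z) / (e0 - e1).
Proof. by move=> e01 <- <-; apply: (mulIf e01); rewrite divfK //; ring. Qed.

Lemma ord3P (i : 'I_3) : [\/ i = 0, i = 1 | i = 2].
Proof.
case: i => -[|[|[|//]]] lt; [apply: Or31|apply: Or32|apply: Or33]; exact/val_inj.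
Qed.

Lemma ord3_sum (V : nmodType) (f : 'I_3 -> V) : \sum_i f i = f 0 + f 1 + f 2.
Proof.
rewrite !big_ord_recl big_ord0 addr0 addrA.
by congr (f _ + f _ + f _); apply/val_inj.
Qed.

Lemma ord4P (i : 'I_4) : i = ord_max \/ exists j, i = widen_ord (leqnSn 3) j.
Proof.
case: (unliftP ord_max i) => [j ->|]; [right; exists j|by left].
by apply/val_inj; rewrite /= /bump leqNgt ltn_ord.
Qed.

Section CurveFunctionField.
Variables (p : nat) (A : idomainType) (k : fieldType) (redk : {rmorphism A -> k}).
Variables (dA : A -> A) (a : 'I_3 -> A) (c : 'I_2 -> A).
Hypotheses (p_prime : prime p) (p_odd : odd p) (hk : residue_field p redk).
Hypothesis k_closed : GRing.closed_field_axiom k.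
Hypothesis ua : (a 0 - a 1) \is a GRing.unit.
Variables (K : fieldType) (iota : {rmorphism J p dA 0 (E0 p a c) -> K}).
Hypothesis iota_frac : is_frac_mod p iota.

Local Notation red := (red_hom iota).
Local Notation cst := (red_const iota).
Local Notation wid := (widen_ord (leqnSn 3)).
Local Notation Fr := (pFrobenius_aut (charK p_prime iota_frac)).
Local Notation "q ^Fr" := (map_poly Fr q) (at level 2, format "q ^Fr").

Let redw : {rmorphism {mpoly A[3]} -> K} := red \o @mwiden 3 A.
Local Notation xK i := (redw 'X_i).
Let yK : K := red 'X_ord_max.

Let redwC x : redw x%:MP = cst x.
Proof. by rewrite -[LHS]/(red (mwiden x%:MP)) mwidenC. Qed.
Let redwD f g : redw (f + g) = redw f + redw g.
Proof. exact: rmorphD. Qed.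
Let redwB f g : redw (f - g) = redw f - redw g.
Proof. exact: rmorphB. Qed.
Let redwM f g : redw (f * g) = redw f * redw g.
Proof. exact: rmorphM. Qed.

Let redwX2 i : redw ('X_i ^+ 2) = redw 'X_i ^+ 2.
Proof. exact: rmorphXn. Qed.

Let red_eqs f : f \in eqs (E0 p a c) -> red f = 0.
Proof. by move=> fS; apply/(red_eq0 iota_frac); apply: in_ideal_mem; rewrite inE fS orbT. Qed.

Let redw_H1 : redw (H1 a) = cst (c 0).
Proof.
apply/eqP; rewrite -subr_eq0 -redwC -redwB; apply/eqP; apply: red_eqs.
by rewrite /= inE eqxx.
Qed.

Let redw_H2 : redw (H2 A) = cst (c 1).
Proof.
apply/eqP; rewrite -subr_eq0 -redwC -redwB; apply/eqP; apply: red_eqs.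
by rewrite /= !inE eqxx orbT.
Qed.

Let yK_Q : yK * redw (Qpol p a) = 1.
Proof.
apply/eqP; rewrite -subr_eq0 -[1](rmorph1 red) -rmorphM -rmorphB; apply/eqP; apply: red_eqs.
by rewrite /= !inE eqxx !orbT.
Qed.

Let xK0 : xK 0 != 0.
Proof.
apply/eqP => x0; have := yK_Q; rewrite !redwM x0 !mul0r mulr0 => /eqP.
by rewrite eq_sym oner_eq0.
Qed.

Let xK1 : xK 1 != 0.
Proof.
apply/eqP => x1; have := yK_Q; rewrite !redwM x1 mulr0 !mul0r mulr0 => /eqP.
by rewrite eq_sym oner_eq0.
Qed.

Let quadric1 : cst (a 0) * xK 0 ^+ 2 + cst (a 1) * xK 1 ^+ 2 + cst (a 2) * xK 2 ^+ 2
  = cst (c 0).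
Proof.
by apply: etrans _ redw_H1; rewrite /H1 ord3_sum -!mul_mpolyC redwD redwD !(redwM _%:MP) !redwC !redwX2.
Qed.

Let quadric2 : xK 0 ^+ 2 + xK 1 ^+ 2 + xK 2 ^+ 2 = cst (c 1).
Proof. by apply: etrans _ redw_H2; rewrite /H2 ord3_sum redwD redwD !redwX2. Qed.

Let cst_ua : cst (a 0) - cst (a 1) != 0.
Proof. by rewrite -rmorphB -unitfE rmorph_unit. Qed.

Local Notation inL := (pspan (charK p_prime iota_frac) (xK 2)).

Let inL_cst x : inL (cst x).
Proof.
(* The monic equation X^p = [redk x]: the right-hand side of the axiom has only a constant term. *)
have [xi hxi] := k_closed (fun i => if i == 0%N then redk x else 0) (prime_gt0 p_prime).
have {}hxi : xi ^+ p = redk x.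
  rewrite hxi (bigD1 (Ordinal (prime_gt0 p_prime))) //= expr0 mulr1 big1 ?addr0 //.
  by move=> i; rewrite -val_eqE /= => /negbTE ->; rewrite mul0r.
have [y hy] := (proj1 hk) xi.
have [z hz] : pmul p 1 (x - y ^+ p).
  by apply/(proj2 hk); rewrite rmorphB rmorphXn hy hxi subrr.
have -> : cst x = cst y ^+ p.
  apply/eqP; rewrite -rmorphXn -subr_eq0 -rmorphB hz expr1 rmorphM rmorph_nat.
  by rewrite (pK0 iota_frac) mul0r.
exact: pspan_pexp.
Qed.

Let inL_x0 : inL (xK 0).
Proof.
apply: (pspan_sqrt p_odd xK0); rewrite (quadrics_solve cst_ua quadric1 quadric2).
apply: pspanM; last by apply: pspanV; rewrite -rmorphB.
apply: pspanD; first by rewrite -rmorphM -rmorphB.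
by apply: pspanM; [rewrite -rmorphB|apply: pspanX; apply: pspan_gen].
Qed.

Let inL_x1 : inL (xK 1).
Proof.
have ua' : cst (a 1) - cst (a 0) != 0 by rewrite -opprB oppr_eq0.
have q1 := quadric1; rewrite [_ * xK 0 ^+ 2 + _]addrC in q1.
have q2 := quadric2; rewrite [xK 0 ^+ 2 + _]addrC in q2.
apply: (pspan_sqrt p_odd xK1); rewrite (quadrics_solve ua' q1 q2).
apply: pspanM; last by apply: pspanV; rewrite -rmorphB.
apply: pspanD; first by rewrite -rmorphM -rmorphB.
by apply: pspanM; [rewrite -rmorphB|apply: pspanX; apply: pspan_gen].
Qed.

Let inL_x i : inL (xK i).
Proof. by have [->|->|->] := ord3P i; [exact: inL_x0|exact: inL_x1|exact: pspan_gen]. Qed.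

Let inL_redw f : inL (redw f).
Proof.
elim/mpoly_closed_ind: f => [x|i|f g Lf Lg|f g Lf Lg].
- by rewrite redwC.
- exact: inL_x.
- by rewrite redwD; apply: pspanD.
- by rewrite redwM; apply: pspanM.
Qed.

Let widX i : mwiden 'X_i = 'X_(wid i) :> {mpoly A[4]}.
Proof. by rewrite mwidenX mnmwiden1. Qed.

Lemma function_field_span z : inL z.
Proof.
have Lred f : inL (red f).
  elim/mpoly_closed_ind: f => [x|i|f g Lf Lg|f g Lf Lg].
  - exact: inL_cst.
  - have [->|[j ->]] := ord4P i; last by rewrite -widX; apply: inL_x.
    have Q0 : redw (Qpol p a) != 0.
      by apply/eqP => Q0; have := yK_Q; rewrite Q0 mulr0 => /eqP; rewrite eq_sym oner_eq0.
    have -> : red 'X_ord_max = (redw (Qpol p a))^-1.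
      by apply: (mulIf Q0); rewrite mulVf //; exact: yK_Q.
    exact: pspanV (inL_redw _).
  - by rewrite rmorphD; apply: pspanD.
  - by rewrite rmorphM; apply: pspanM.
have [b [b' [_ ->]]] := proj2 iota_frac z.
by rewrite !(iota_rep iota_frac); apply: pspanM => //; apply: pspanV.
Qed.

Let mderiv_mwiden i (f : {mpoly A[3]}) :
  (mwiden f)^`M(wid i) = mwiden f^`M(i).
Proof.
elim/mpoly_closed_ind: f => [x|j|f g IHf IHg|f g IHf IHg].
- by rewrite mwidenC !mderivC mwiden0.
- by rewrite widX !mderivU rmorph_nat.
- by rewrite mwidenD !mderivD IHf IHg mwidenD.
- by rewrite mwidenM !mderivM IHf IHg mwidenD !mwidenM.
Qed.

Let mderiv_mwiden_max (f : {mpoly A[3]}) : (mwiden f)^`M(ord_max) = 0.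
Proof.
elim/mpoly_closed_ind: f => [x|j|f g IHf IHg|f g IHf IHg].
- by rewrite mwidenC mderivC.
- by rewrite widX mderivU -val_eqE /= ltn_eqF.
- by rewrite mwidenD mderivD IHf IHg addr0.
- by rewrite mwidenM mderivM IHf IHg mul0r mulr0 addr0.
Qed.

(* The derivation dual to omega_c. *)
Lemma omega_derivation : exists D : K -> K,
  [/\ twisted_der idfun D, forall x, D (cst x) = 0
    & forall i, D (xK i) =
        (cst (a (i + 1)) - cst (a (i + 2))) * (xK (i + 1) * xK (i + 2))].
Proof.
pose t i := (cst (a (i + 1)) - cst (a (i + 2))) * (xK (i + 1) * xK (i + 2)).
(* Dictated by differentiating y Q = 1. *)
pose dy := - yK ^+ 2 * tangent redw t (Qpol p a).
pose t4 (i : 'I_4) := if unlift ord_max i is Some j then t j else dy.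
pose d4 := tangent red t4.
have d4_der : twisted_der red d4 := tangent_der red t4.
have t4w i : t4 (wid i) = t i.
  rewrite /t4 (_ : wid i = lift ord_max i) ?liftK //.
  by apply/val_inj; rewrite /= /bump leqNgt ltn_ord.
have d4w f : d4 (mwiden f) = tangent redw t f.
  rewrite /d4 /tangent big_ord_recr mderiv_mwiden_max (rmorph0 red) mul0r.
  rewrite -[LHS]/(\sum_(i < 3) red (mwiden f)^`M(wid i) * t4 (wid i) + 0) addr0.
  by apply: eq_bigr => i _; rewrite mderiv_mwiden t4w.
have d4C x : d4 x%:MP = 0 := tangentC red t4 x.
have d4x i : d4 (mwiden 'X_i) = t i by rewrite d4w tangentX.
have d4y : d4 'X_ord_max = dy by rewrite /d4 tangentX /t4 unlift_none.
have t0 : t 0 = (cst (a 1) - cst (a 2)) * (xK 1 * xK 2).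
  by congr ((cst (a _) - cst (a _)) * (xK _ * xK _)); apply/val_inj.
have t1 : t 1 = (cst (a 2) - cst (a 0)) * (xK 2 * xK 0).
  by congr ((cst (a _) - cst (a _)) * (xK _ * xK _)); apply/val_inj.
have t2 : t 2 = (cst (a 0) - cst (a 1)) * (xK 0 * xK 1).
  by congr ((cst (a _) - cst (a _)) * (xK _ * xK _)); apply/val_inj.
have d4sq i : d4 (mwiden ('X_i ^+ 2)) = 2 * xK i * t i.
  by rewrite expr2 mwidenM (proj2 d4_der) d4x -[red _]/(xK i); ring.
have quad (b : 'I_3 -> A) e : d4 (mwiden (\sum_i b i *: 'X_i ^+ 2 - e%:MP)) =
    2 * (cst (b 0) * (xK 0 * t 0) + cst (b 1) * (xK 1 * t 1) + cst (b 2) * (xK 2 * t 2)).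
  have dZ i : d4 (mwiden (b i *: 'X_i ^+ 2)) = cst (b i) * (2 * xK i * t i).
    rewrite -mul_mpolyC mwidenM mwidenC (proj2 d4_der) d4C mulr0 addr0 d4sq.
    by [].
  rewrite mwidenB mwidenC (twisted_derB d4_der) d4C subr0 ord3_sum.
  rewrite !mwidenD !(proj1 d4_der) !dZ; move: (xK 0) (xK 1) (xK 2) => x0 x1 x2.
  by move: (cst (b 0)) (cst (b 1)) (cst (b 2)) (t 0) (t 1) (t 2) => *; ring.
have d4_ker f : red f = 0 -> d4 f = 0.
  move=> /(red_eq0 iota_frac) hf.
  have hI : ideal_pred (fun f => red f = 0 /\ d4 f = 0).
    split=> [|f1 f2 [r1 h1] [r2 h2]|f1 f2 [r2 h2]].
    - by rewrite rmorph0 (twisted_der0 d4_der).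
    - by rewrite rmorphB r1 r2 (twisted_derB d4_der) h1 h2 subrr.
    - by rewrite rmorphM r2 mulr0 (proj2 d4_der) h2 r2 mul0r mulr0 addr0.
  suff [] : red f = 0 /\ d4 f = 0 by [].
  apply: (in_ideal_sub hI _ hf) => g gI.
  split; first by apply/(red_eq0 iota_frac); apply: in_ideal_mem.
  move: gI; rewrite /= !inE => /or4P[] /eqP ->.
  - by rewrite expr1 -mpolyC_nat d4C.
  (* Here the cyclic sum of a_i (a_(i+1) - a_(i+2)) vanishes; for [H2] it is the sum of the
     differences themselves. *)
  - rewrite quad t0 t1 t2; move: (xK 0) (xK 1) (xK 2) => x0 x1 x2.
    by move: (cst (a 0)) (cst (a 1)) (cst (a 2)) => *; ring.
  - have -> : H2 A = \sum_i 1 *: 'X_i ^+ 2 by apply: eq_bigr => i _; rewrite scale1r.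
    rewrite (quad (fun=> 1)) rmorph1 t0 t1 t2; move: (xK 0) (xK 1) (xK 2) => x0 x1 x2.
    by move: (cst (a 0)) (cst (a 1)) (cst (a 2)) => *; ring.
  - rewrite (twisted_derB d4_der) (twisted_der1 d4_der) subr0 (proj2 d4_der) d4w d4y.
    rewrite -[red 'X_ord_max]/yK -[red (mwiden _)]/(redw (Qpol p a)) /dy.
    move: (tangent _ _ _) yK (redw _) yK_Q => u y q yq.
    have -> : y * u + q * (- y ^+ 2 * u) = y * u * (1 - y * q) by ring.
    by rewrite yq subrr mulr0.
have red_frac z : exists f g, red g != 0 /\ z = red f / red g.
  have [b [b' [nz ->]]] := proj2 iota_frac z.
  by exists (rep b 1), (rep b' 1); rewrite -!(iota_rep iota_frac).
have [D [hD DE]] := fraction_der (F := idfun) (d4_der : twisted_der (idfun \o red) d4) d4_ker red_frac.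
exists D; split=> [//|x|i]; first exact: etrans (DE x%:MP) (d4C x).
exact: etrans (DE (mwiden 'X_i)) (d4x i).
Qed.

Lemma omega_derivation_neq0 D :
  (forall i, D (xK i) =
     (cst (a (i + 1)) - cst (a (i + 2))) * (xK (i + 1) * xK (i + 2))) ->
  D (xK 2) != 0.
Proof.
move=> ->; rewrite (_ : 2 + 1 = 0 :> 'I_3); last exact/val_inj.
rewrite (_ : 2 + 2 = 1 :> 'I_3); last exact/val_inj.
exact: mulf_neq0 cst_ua (mulf_neq0 xK0 xK1).
Qed.

End CurveFunctionField.

(** * The tautological point of E_c^0 and the restriction of omega_c *)

Section AffinePoints.
Variables (A : comNzRingType) (a : 'I_3 -> A) (c : 'I_2 -> A).

Lemma aff_pt_row0 (S : affine A) (x : 'I_3 -> {mpoly A[nv S]}) j :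
  aff_pt x ord0 (lift ord0 j) = x j.
Proof. by rewrite mxE eqxx liftK. Qed.

Lemma aff_pt_origin (S : affine A) (x : 'I_3 -> {mpoly A[nv S]}) :
  aff_pt x ord0 ord0 = 1.
Proof. by rewrite mxE eqxx unlift_none. Qed.

Lemma aff_pt_row (S : affine A) (x : 'I_3 -> {mpoly A[nv S]}) i j :
  aff_pt x (lift ord0 i) j = 0.
Proof. by rewrite mxE. Qed.

Lemma aff_pt_is_pt (S : affine A) (x : 'I_3 -> {mpoly A[nv S]}) :
  in_ideal (eqs S) (\sum_j a j *: x j ^+ 2 - (c 0)%:MP) ->
  in_ideal (eqs S) (\sum_j x j ^+ 2 - (c 1)%:MP) ->
  is_pt a c (aff_pt x).
Proof.
move=> h0 h1; split.
- rewrite /mxtrace big_ord_recl aff_pt_origin big1 => [|i _].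
    by rewrite addr0 subrr; apply: in_ideal0.
  exact: aff_pt_row.
- move=> i j i' j'; rewrite (_ : _ - _ = 0); first exact: in_ideal0.
  case: (unliftP ord0 i) => [k ->|->]; first by rewrite !aff_pt_row !mul0r subrr.
  case: (unliftP ord0 i') => [k ->|->]; first by rewrite !aff_pt_row !mulr0 subrr.
  by rewrite mulrC subrr.
- move=> i; case: (unliftP ord0 i) => [k ->|->].
    rewrite aff_pt_row expr0n scaler0 subr0 big1 => [|j _]; first exact: in_ideal0.
    by rewrite aff_pt_row expr0n scaler0.
  rewrite aff_pt_origin expr1n alg_mpolyC.
  by under eq_bigr do rewrite aff_pt_row0.
- move=> i; case: (unliftP ord0 i) => [k ->|->].
    rewrite aff_pt_row expr0n scaler0 subr0 big1 => [|j _]; first exact: in_ideal0.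
    by rewrite aff_pt_row expr0n.
  rewrite aff_pt_origin expr1n alg_mpolyC.
  by under eq_bigr do rewrite aff_pt_row0.
Qed.

End AffinePoints.

Section RestrictionOfOmega.
Variables (A : comNzRingType) (p : nat) (dA : A -> A) (a : 'I_3 -> A) (c : 'I_2 -> A).

Let wid (i : 'I_3) : {mpoly A[4]} := 'X_(widen_ord (leqnSn 3) i).

Lemma mwiden_eqs f : f \in eqs (Ec a c) -> mwiden f \in eqs (E0 p a c).
Proof. by rewrite /= !inE => /orP[] /eqP ->; rewrite eqxx ?orbT. Qed.

(** Through naturality of omega, this identifies its value at the tautological point with the
    restriction to E_c^0 of the form on E_c, to which hypothesis (2) applies. *)
Lemma taut_pt_pull : @pt_pull A a c (E0 p a c) (Ec a c) wid
  (aff_pt (S := Ec a c) (fun i => 'X_i)) (taut_pt p a c).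
Proof.
have mor : @is_mor A (E0 p a c) (Ec a c) wid.
  by move=> f /mwiden_eqs; apply: in_ideal_mem.
have tautE : taut_pt p a c = map_mx (subst wid) (aff_pt (S := Ec a c) (fun i => 'X_i)).
  apply/matrixP => i j; case: (unliftP ord0 i) => [k ->|->]; rewrite [RHS]mxE.
    by rewrite aff_pt_row (@aff_pt_row _ (Ec a c)) subst0.
  case: (unliftP ord0 j) => [k ->|->]; first by rewrite aff_pt_row0 (@aff_pt_row0 _ (Ec a c)) substX.
  by rewrite aff_pt_origin (@aff_pt_origin _ (Ec a c)) subst1.
have E_pt : is_pt a c (aff_pt (S := Ec a c) (fun i => 'X_i)).
  by apply: aff_pt_is_pt; apply: in_ideal_mem; rewrite !inE eqxx ?orbT.
have E0_pt : is_pt a c (taut_pt p a c).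
  apply: aff_pt_is_pt; apply: in_ideal_mem.
    have <- : mwiden (H1 a - (c 0)%:MP) = \sum_j a j *: wid j ^+ 2 - (c 0)%:MP.
      rewrite mwidenB mwidenC /H1 rmorph_sum; congr (_ - _); apply: eq_bigr => i _ /=.
      by rewrite mwidenZ rmorphXn /= mwidenX mnmwiden1.
    by apply: mwiden_eqs; rewrite !inE eqxx.
  have <- : mwiden (H2 A - (c 1)%:MP) = \sum_j wid j ^+ 2 - (c 1)%:MP.
    rewrite mwidenB mwidenC /H2 rmorph_sum; congr (_ - _); apply: eq_bigr => i _ /=.
    by rewrite rmorphXn /= mwidenX mnmwiden1.
  by apply: mwiden_eqs; rewrite !inE eqxx orbT.
split=> //; rewrite -tautE => i j i' j'.
by case: E0_pt => _ + _ _; apply.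
Qed.

Lemma omega0_chart (w : Om p dA 0 (Ec a c)) i : is_omega w ->
  jscale (jof p dA (r := 0) (S := E0 p a c)
    (mwiden ((a (i + 1) - a (i + 2)) *: ('X_(i + 1) * 'X_(i + 2)))))
    (omega0 w) = dJ (jof p dA (r := 0) (S := E0 p a c) (mwiden 'X_i)).
Proof.
move=> hw; pose v (i : 'I_3) := @jX p A dA 0 (E0 p a c) (widen_ord (leqnSn 3) i).
have evlw f : evl v f = jof p dA (r := 0) (S := E0 p a c) (mwiden f).
  exact: (@evl_jof p A dA 0 (E0 p a c) 3 wid).
have v0 g : g \in jeqs p dA 0 (Ec a c) -> evl v g = 0.
  by move=> gE; rewrite evlw; apply: (@jof_eqs p A dA (E0 p a c) 0); apply: mwiden_eqs.
have := congr1 (@pull_form p A dA 0 0 (Ec a c) (E0 p a c) v) (hw i).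
rewrite (pull_form_jscale v0) (pull_form_dJ v0) (pull_jof v0) !evlw.
exact.
Qed.

End RestrictionOfOmega.

Theorem theorem4p7 (p : nat) (A : idomainType) (k : fieldType)
    (red : {rmorphism A -> k}) (dA : A -> A) (a : 'I_3 -> A)
    (dX : J p dA 0 (X p a) -> J p dA 0 (X p a))
    (c : 'I_2 -> A)
    (dc : J p dA 0 (E0 p a c) -> J p dA 0 (E0 p a c))
    (add : forall S : affine A, pmat S -> pmat S -> pmat S)
    (opp : forall S : affine A, pmat S -> pmat S)
    (zero : forall S : affine A, pmat S)
    (omega : forall S : affine A, pmat S -> Om p dA 0 S)
    (psi : forall S : affine A, pmat S -> J p dA 2 S)
    (K : fieldType) (iota : {rmorphism J p dA 0 (E0 p a c) -> K}) :
  prime p -> odd p ->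
  cdvr p A ->
  residue_field p red -> GRing.closed_field_axiom k ->
  p_derivation p dA ->
  (a 0 - a 1) * (a 1 - a 2) * (a 2 - a 0) \is a GRing.unit ->
  (forall i, in_Zp p (a i)) ->
  flow dX ->
  dX (jof p dA (r := 0) (S := X p a) (mwiden (H1 a))) = 0 ->
  dX (jof p dA (r := 0) (S := X p a) (mwiden (H2 A))) = 0 ->
  (forall (b : 'I_2 -> A) (db : J p dA 0 (E0 p a b) -> J p dA 0 (E0 p a b))
      (w : Om p dA 0 (Ec a b)),
     (forall i, dA (b i) = 0) ->
     (Npol a).@[b] * (hasse p a).@[b] \is a GRing.unit ->
     induced dX db -> is_omega w ->
     exists eta,
       frob_form db (omega0 w) - ascale ((hasse p a).@[b])^-1 (omega0 w)
       = eta *+ p) ->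
  (forall i, in_Zp p (c i)) ->
  (forall i, dA (c i) = 0) ->
  (Npol a).@[c] * (hasse p a).@[c] \is a GRing.unit ->
  ~ has_frobenius_lift p dA a c ->
  induced dX dc ->
  group_law a c add opp zero ->
  is_form a c omega ->
  is_omega (omega (Ec a c) (aff_pt (S := Ec a c) (fun i => 'X_i))) ->
  canonical_character a c add omega psi ->
  is_frac_mod p iota ->
  exists z : K, z ^+ p = iota (sig_pull dc (psi (E0 p a c) (taut_pt p a c))).
Proof.
move=> p_prime p_odd [p0 _ _ _] hk k_closed hdA ua _ _ _ _ hyp2 _ dc0 uN _ hind _ hom hw.
move=> [_ _ [l1 [l0 hpsi]]] iota_frac; have [hd _] := hind.
have {}ua : (a 0 - a 1) \is a GRing.unit by move: ua; rewrite !unitrM => /andP[/andP[]].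
have A_tf (x : A) : p%:R * x = 0 -> x = 0.
  by move/eqP; rewrite mulf_eq0 (negbTE p0) => /eqP.
have B_tf (x : J p dA 0 (E0 p a c)) : p%:R * x = 0 -> x = 0.
  by apply: adic_limit_torsion_free; apply: E0_saturated.
set gen := aff_pt _ in hw.
have [eta heta] := hyp2 c dc _ dc0 uN hind hw.
have pull_pt := taut_pt_pull p a c; have [_ _ taut _] := pull_pt.
have := hpsi _ _ taut; rewrite (hom _ _ _ _ _ pull_pt) => hdpsi.
have [D [hD D_cst D_x]] := omega_derivation iota_frac.
have Dx := omega_derivation_neq0 ua iota_frac D_x.
have span := function_field_span p_prime p_odd hk k_closed ua iota_frac.
apply: (canonical_pullback_is_pth_power hdA A_tf hd B_tf hD D_cst Dx span _ heta hdpsi).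
(* In this chart (a_0 - a_1) x_0 x_1 omega = dx_2, and the coefficient is D x_2 by the choice of D;
   so omega contracts with D to 1. *)
have chart := omega0_chart 2 hw.
have := congr1 (@pair p A dA _ dc K iota D 0) chart.
rewrite (pair_jscale p_prime hdA hd B_tf iota_frac hD D_cst) jet_val0.
rewrite (pair_dJ_jof p_prime hdA hd B_tf iota_frac hD D_cst) => e.
have eT : red_hom iota (mwiden ((a (2 + 1) - a (2 + 2)) *: ('X_(2 + 1) * 'X_(2 + 2)))) =
    D ((red_hom iota \o mwiden (R:=A)) 'X_2).
  rewrite D_x -mul_mpolyC mwidenM mwidenC (rmorphM (red_hom iota)).
  rewrite -(rmorphB (red_const iota)); congr (_ * _).
  by rewrite mwidenM (rmorphM (red_hom iota)).
by apply: (mulfI Dx); rewrite mulr1 -{1}eT; apply: e.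
Qed.
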